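(* Let $X$ and $Y$ be Banach spaces, let $\Theta:X\to(-\infty,\infty]$ be a proper, lower semi-continuous, $p$-convex function for some $p\ge 2$ (with constant $\gamma$), let $\{\alpha_n\}$ be a sequence with $\alpha_n>0$, $1\le \alpha_n/\alpha_{n+1}\le\theta$ and $\lim_{n\to\infty}\alpha_n=0$ for some constant $\theta>1$, and let $F$ satisfy conditions (a)--(d) of the context. If the source condition $$\langle\xi_0-\xi^\dagger,x-x^\dagger\rangle\le\beta\left[D_{\xi^\dagger}\Theta_F(x,x^\dagger)\right]^{\frac{1-\nu}p}\|T(x-x^\dagger)\|^\nu,\qquad\forall x\in X$$ is satisfied with some $0<\nu\le1$ and $\beta\ge0$, and if $\mathcal E:=(K_0+K_1)\|\xi_0-\xi^\dagger\|^{\frac1{p-1}}$ is sufficiently small, then for the integer $n_\delta$ determined by either Rule 2 or Rule 3 (see context) with $\tau>1$ there holds $$D_{\xi^\dagger}\Theta_F(x_{n_\delta}^\delta,x^\dagger)\le C\beta^{\frac p{p-1+\nu}}\delta^{\frac{p\nu}{p-1+\nu}}$$ and thus $$\|x_{n_\delta}^\delta-x^\dagger\|\le C\beta^{\frac1{p-1+\nu}}\delta^{\frac\nu{p-1+\nu}},$$ where $C$ is a constant depending only on $p$, $\gamma$, $\theta$, $\tau$ and $\nu$.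
   Context: $\|\cdot\|$ denotes the norms of $X$, $Y$ and the dual norm of $X^*$; $\langle\xi,x\rangle=\xi(x)$ for $\xi\in X^*$, $x\in X$. Convexity. For a proper convex $\Theta:X\to(-\infty,\infty]$: $D(\Theta)=\{x:\Theta(x)<\infty\}$; $\partial\Theta(x)=\{\xi\in X^*:\Theta(z)-\Theta(x)-\langle\xi,z-x\rangle\ge0\ \forall z\in X\}$; $D(\partial\Theta)=\{x\in D(\Theta):\partial\Theta(x)\neq\emptyset\}$; for $\xi\in\partial\Theta(x)$ the Bregman distance is $D_\xi\Theta(z,x)=\Theta(z)-\Theta(x)-\langle\xi,z-x\rangle$. $\Theta$ is $p$-convex ($p\ge2$) if there is $C_0>0$ with $\Theta(\lambda z+(1-\lambda)x)+C_0\lambda(1-\lambda)\|z-x\|^p\le\lambda\Theta(z)+(1-\lambda)\Theta(x)$ for all $x,z\in X$, $\lambda\in(0,1)$; equivalently, there is $\gamma>0$ with $\|z-x\|\le\gamma[D_\xi\Theta(z,x)]^{1/p}$ for all $z\in X$, $x\in D(\partial\Theta)$, $\xi\in\partial\Theta(x)$. Such a constant $\gamma$ is fixed. Operator. $F:D(F)\subset X\to Y$ is a (nonlinear) operator, $y\in Y$, $B_\rho(x^\dagger)=\{x\in X:\|x-x^\dagger\|<\rho\}$. Conditions on $F$: (a) $D(F)$ is closed and convex in $X$ and $F(x)=y$ has a solution $x^\dagger\in D(F)\cap D(\partial\Theta)$; (b) there is $\rho>0$ such that for each $x\in B_\rho(x^\dagger)\cap D(F)$ there is a bounded linear operator $F'(x):X\to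 Y$ with $\lim_{t\searrow0}\frac{F(x+t(z-x))-F(x)}{t}=F'(x)(z-x)$ for all $z\in B_\rho(x^\dagger)\cap D(F)$; (c) $T:=F'(x^\dagger)$ is properly scaled so that $\|T\|\le\alpha_0^{1/p}/\gamma$; (d) there are constants $K_0,K_1\ge0$ with $\|[F'(z)-F'(x)]w\|\le K_0\|z-x\|\,\|F'(x)w\|+K_1\|F'(x)(z-x)\|\,\|w\|$ for all $w\in X$ and $x,z\in B_\rho(x^\dagger)\cap D(F)$. Method. $\Theta_F(x)=\Theta(x)$ if $x\in D(F)$ and $+\infty$ otherwise. Given $\xi_0\in X^*$, $x_0:=\nabla\Theta_F^*(\xi_0)$ ($\Theta_F^*$ the Fenchel conjugate), i.e. $x_0$ is the unique minimizer of $\Theta_F(x)-\langle\xi_0,x\rangle$ over $X$, so $\xi_0\in\partial\Theta_F(x_0)$. $\xi^\dagger\in\partial\Theta_F(x^\dagger)$ is the unique element of $\partial\Theta_F(x^\dagger)$ with $\|\xi_0-\xi^\dagger\|$ equal to the distance from $\xi_0$ to $\partial\Theta_F(x^\dagger)$. For $\delta>0$ and $y^\delta\in Y$ with $\|y^\delta-y\|\le\delta$, set $x_0^\delta:=x_0$ and let $x_{n+1}^\delta$ be the unique minimizer over $x\in X$ of $$\|y^\delta-F(x_n^\delta)-F'(x_n^\delta)(x-x_n^\delta)\|^p+\alpha_nD_{\xi_0}\Theta_F(x,x_0),$$ where $F'(x_n^\delta)$ is the operator from (b). In the source condition, $[\cdot]^0=1$ when $\nu=1$, and for $\nu<1$ the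 inequality is regarded as trivially satisfied when $D_{\xi^\dagger}\Theta_F(x,x^\dagger)=+\infty$. Stopping rules, for given $\tau>1$. Rule 2: if $\|F(x_0)-y^\delta\|\le\tau\delta$ then $n_\delta=0$; otherwise $n_\delta\ge1$ is the first integer with $\frac12(\|F(x_{n_\delta}^\delta)-y^\delta\|+\|F(x_{n_\delta-1}^\delta)-y^\delta\|)\le\tau\delta$. Rule 3: if $\|F(x_0)-y^\delta\|\le\tau\delta$ then $n_\delta=0$; otherwise $n_\delta\ge2$ is the first integer with $\max\{\|F(x_{n_\delta}^\delta)-y^\delta\|,\|F(x_{n_\delta-1}^\delta)-y^\delta\|\}\le\tau\delta$. ''Sufficiently small'' means: below a positive threshold independent of $n$, $\delta$ and $y^\delta$.
   Formalization: If K_0=K_1=0, then E=0 cannot keep the iterates in B_ρ(x†), where F' and the conditions on F are available, and the rate can fail (e.g. F(x_0)=y with x_0 outside the ball); in that case only, x_n^δ in B_ρ(x†) for n≤n_δ is assumed. *)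

(* Defs.v *)
(* MathComp-Analysis, over an abstract R : realType. *)
From HB Require Import structures.
From mathcomp Require Import all_boot all_order all_algebra.
From mathcomp Require Import all_classical all_reals all_analysis.

Set Implicit Arguments.
Unset Strict Implicit.
Unset Printing Implicit Defensive.

Import Order.TTheory GRing.Theory Num.Theory.
Import numFieldNormedType.Exports.

Local Open Scope classical_set_scope.
Local Open Scope ring_scope.

(* A meaningful norm only for bounded linear f: otherwise reals.sup is junk.
   With V := R^o this is the dual norm; elements of the dual of X are the
   xi : {linear X -> R^o} with [continuous xi], and differences of two of them
   are taken pointwise (xi \- eta). *)
Definition opnorm {R : realType} {X V : normedModType R} (f : X -> V) : R :=
  sup [set `|f x| | x in [set x : X | `|x| <= 1]].

Section convex_analysis.
Context {R : realType} {X : normedModType R}.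
Implicit Types (Theta : X -> \bar R) (xi : {linear X -> R^o}) (D : set X).

Definition proper_function Theta :=
  (forall x, Theta x != -oo%E) /\ (exists x, (Theta x < +oo)%E).

Definition p_convex (p : R) Theta :=
  exists2 C0 : R, 0 < C0 &
    forall (x z : X) (lam : R), 0 < lam < 1 ->
      (Theta (lam *: z + (1 - lam) *: x)%R
         + (C0 * lam * (1 - lam) * `|z - x| `^ p)%:E
       <= lam%:E * Theta z + (1 - lam)%:E * Theta x)%E.

Definition bregman Theta xi (z x : X) : \bar R :=
  (Theta z - Theta x - (xi (z - x)%R)%:E)%E.

(* Empty where Theta x = +oo (for a proper Theta), since +oo - +oo = -oo. *)
Definition subdifferential Theta (x : X) : set {linear X -> R^o} :=
  fun xi => continuous (xi : X -> R^o) /\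
    forall z, (0 <= bregman Theta xi z x)%E.

Definition dom_subdifferential Theta : set X :=
  [set x | (Theta x < +oo)%E /\ subdifferential Theta x !=set0].

Definition bregman_constant (p gamma : R) Theta :=
  0 < gamma /\
  forall z x xi, dom_subdifferential Theta x -> subdifferential Theta x xi ->
    (`|z - x|%:E <= gamma%:E * (bregman Theta xi z x `^ p^-1))%E.

Definition restrict_to D Theta : X -> \bar R :=
  fun x => if x \in D then Theta x else +oo%E.

Definition minimizes (f : X -> \bar R) (x : X) := forall z, (f x <= f z)%E.

Definition nearest_in (A : set {linear X -> R^o}) xi0 xi :=
  A xi /\ opnorm (xi0 \- xi) = inf [set opnorm (xi0 \- eta) | eta in A].

(* The guard is only effective for nu < 1, where the inequality is void at an
   infinite Bregman distance (not so in \bar R, as +oo * 0 = 0). For nu = 1 the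
   power of the Bregman distance is 1, also at +oo (poweRe0). *)
Definition source_condition (Y : normedModType R) (p nu beta : R) Theta
    xi0 xidag (xdag : X) (T : X -> Y) :=
  forall x : X,
    (nu < 1 -> (bregman Theta xidag x xdag < +oo)%E) ->
    ((xi0 (x - xdag)%R - xidag (x - xdag)%R)%R%:E
     <= beta%:E * (bregman Theta xidag x xdag `^ ((1 - nu) / p))
        * (`|T (x - xdag)%R| `^ nu)%R%:E)%E.

End convex_analysis.

Section operator.
Context {R : realType} {X Y : normedModType R}.
Variables (D : set X) (F : X -> Y) (F' : X -> {linear X -> Y}).
Variables (xdag : X) (rho : R).

Let region : set X := [set x | D x /\ `|x - xdag| < rho].

Definition directional_derivative :=
  forall x, region x -> continuous (F' x) /\
    forall z, region z ->
      t^-1 *: (F (x + t *: (z - x)) - F x) @[t --> 0^'+] --> F' x (z - x).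

Definition nonlinearity_condition (K0 K1 : R) :=
  forall x z w, region x -> region z ->
    `|F' z w - F' x w|
      <= K0 * `|z - x| * `|F' x w| + K1 * `|F' x (z - x)| * `|w|.

End operator.

Section method.
Context {R : realType} {X Y : normedModType R}.

Definition gauss_newton_functional (p : R) (Theta_F : X -> \bar R)
    (F : X -> Y) (F' : X -> {linear X -> Y}) (ydelta : Y)
    (xi0 : {linear X -> R^o}) (x0 : X) (alphan : R) (xn : X) : X -> \bar R :=
  fun x => ((`|ydelta - F xn - F' xn (x - xn)| `^ p)%R%:E
            + alphan%:E * bregman Theta_F xi0 x x0)%E.

(* Only the iterates x 0, ..., x N are constrained: x N is the one returned by
   the stopping rule and nothing guarantees that later iterates stay where F'
   is a derivative of F. Minimizers are unique, by p-convexity. *)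
Definition gauss_newton_iterates (p : R) (Theta_F : X -> \bar R)
    (F : X -> Y) (F' : X -> {linear X -> Y}) (ydelta : Y)
    (xi0 : {linear X -> R^o}) (alpha : nat -> R) (x : nat -> X) (N : nat) :=
  minimizes (fun z => Theta_F z - (xi0 z)%:E)%E (x 0%N) /\
  forall n, (n < N)%N ->
    minimizes
      (gauss_newton_functional p Theta_F F F' ydelta xi0 (x 0%N) (alpha n) (x n))
      (x n.+1).

End method.

Section stopping.
Context {R : realType}.
(* res n is the residual norm of the n-th iterate, tol is tau * delta. *)
Variables (res : nat -> R) (tol : R).

Definition mean_small (n : nat) := 2^-1 * (res n + res n.-1) <= tol.
Definition max_small (n : nat) := Num.max (res n) (res n.-1) <= tol.

Definition stops_mean (N : nat) :=
  if res 0%N <= tol then N = 0%N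
  else [/\ (1 <= N)%N, mean_small N &
           forall n, (1 <= n < N)%N -> ~ mean_small n].

Definition stops_max (N : nat) :=
  if res 0%N <= tol then N = 0%N
  else [/\ (2 <= N)%N, max_small N &
           forall n, (1 <= n < N)%N -> ~ max_small n].

End stopping.

(* Main.v *)
Require Import Defs.
From HB Require Import structures.
From mathcomp Require Import all_boot all_order all_algebra.
From mathcomp Require Import all_classical all_reals all_analysis.
From mathcomp Require Import ring lra.

Import Order.TTheory GRing.Theory Num.Theory.
Import numFieldNormedType.Exports.

Local Open Scope classical_set_scope.
Local Open Scope ring_scope.

(** Write e_n = x_n - xdag, t_n = |T e_n| and D_n for the Bregman distance of
    [Theta_F] from xdag to x_n.  Comparing x_(n+1) with xdag in the minimization
    problem that defines it gives the energy inequality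

      r_n^p + alpha_n D_(n+1) <= d_n^p + alpha_n <xi0 - xidag, e_(n+1)>,

    where r_n and d_n are the norms of the linearized residuals at x_(n+1) and at
    xdag ([newton_minimizer]).  As long as (K0 + K1) |e_n| is small, the
    nonlinearity condition gives d_n <= delta + small * t_n, and it makes both
    t_(n+1) and the residual of x_(n+1) comparable to r_n, up to delta and small
    multiples of t_n and t_(n+1) ([newton_step_estimates]).

    With v_(n+1)^p = alpha_n D_(n+1) the cross term takes the form
    w_n^(p-1) (v_(n+1) + t_(n+1)) for two choices of w_n: one from the crude bound
    by |xi0 - xidag| |e_(n+1)|, where w_n is a multiple of
    |xi0 - xidag|^(1/(p-1)) alpha_n^(1/p), and one from the source condition,
    where w_n = (alpha_n^((p-1+nu)/p) beta)^(1/(p-1)).  In both cases Young's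
    inequality with a small parameter and an induction on n
    ([residual_recursion]) give

      t_n <= C (delta + w_n)   and   res_n <= (1 + tau)/2 delta + C w_n.

    The gain of (1 + tau)/2 over tau decides.  For the first choice of w_n, two
    consecutive residuals are at most tau delta soon after delta exceeds a fixed
    multiple of w_n, so up to the stopping index delta is at most a multiple of
    w_n; the energy inequality then keeps e_n within a multiple of
    |xi0 - xidag|^(1/(p-1)), and the smallness assumption propagates along the
    iteration.  For the second choice, a residual above tau delta just before the
    stopping index forces delta <= C w_n there, that is, a lower bound for
    alpha_n; the residuals at the end are at most 2 tau delta, so t and d are
    O(delta), and the energy inequality yields the rate ([rate_of_energy],
    [abstract_rates]).

    The bound |z - xdag|^p <= gamma^p D(z, xdag) is needed for [Theta_F], whereas
    [gamma] is a constant of [Theta], and a subgradient of [Theta_F] need not be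
    one of [Theta].  It follows from the density of the points at which [Theta]
    has a subgradient ([subgradient_approx], [bregman_restrict_ge]), which rests
    on the existence of minimizers and on the Hahn-Banach theorem
    ([convex_dominates_linear]).  The latter also reduces the mean value
    inequality for F to the scalar one ([mean_value_norm]). *)

(** * Linear functionals dominated by convex functions *)

(** A convex function that is nonnegative at 0 dominates a linear functional: the
    analytic form of the Hahn-Banach theorem, by Zorn's lemma on the graphs of
    linear functionals defined on a subspace and dominated there.  A linear
    relation below the graph of [phi] is single valued, so that functionality
    need not be imposed on the graphs. *)
Lemma convex_dominates_linear (R : realType) (X : lmodType R) (phi : X -> R) :
  (forall x y (a : R), 0 <= a <= 1 ->
     phi (a *: x + (1 - a) *: y) <= a * phi x + (1 - a) * phi y) ->
  0 <= phi 0 ->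
  exists xi : {linear X -> R^o}, forall x, xi x <= phi x.
Proof.
move=> cphi phi0.
pose P (G : set (X * R^o)) :=
  (forall a u v, G u -> G v -> G (a *: u + v)) /\
  (forall u, G u -> u.2 <= phi u.1).
have [|A [[Alin Aphi] Amax]] := @Zorn_bigcup _ P.
  move=> C CP Ctot; split.
    move=> a u v [G1 CG1 G1u] [G2 CG2 G2v].
    have [G12|G21] := Ctot _ _ CG1 CG2.
      by exists G2 => //; apply: (CP _ CG2).1 => //; exact: G12.
    by exists G1 => //; apply: (CP _ CG1).1 => //; exact: G21.
  by move=> u [G CG Gu]; exact: (CP _ CG).2.
have A0 : A (0, 0).
  have [/set0P [u Au]|] := boolP (A != set0).
    have := Alin (-1) u u Au Au.
    by rewrite scaleN1r addNr.
  rewrite negbK => /eqP A0.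
  exfalso; apply: (Amax [set (0, 0)]).
    by rewrite A0; split; [exact: sub0set|move=> /(_ (0,0)); apply].
  split=> [a u v -> ->|u ->//].
  by rewrite scaler0 addr0.
have AZ a u : A u -> A (a *: u).
  by move=> Au; have := Alin a u (0, 0) Au A0; rewrite addr0.
have Afun x r s : A (x, r) -> A (x, s) -> r = s.
  move=> Ar As; apply/eqP; rewrite -subr_eq0; apply/eqP.
  have A1 : A (0, r - s).
    have := Alin (-1) _ _ As Ar.
    have -> // : -1 *: ((x, s) : X * R^o) + (x, r) = (0, r - s).
    rewrite scaleN1r; congr pair => /=; first by rewrite addNr.
    by rewrite addrC.
  have A2 t : t * (r - s) <= phi 0.
    have /Aphi /= := AZ t _ A1.
    by rewrite scaler0.
  apply/eqP; apply: contraT => d0.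
  have := A2 ((phi 0 + 1) / (r - s)).
  by rewrite divfK // -subr_ge0 opprD addNKr ler0N1.
have Atot v : exists r, A (v, r).
  apply: contrapT => /forallNP vA.
  (* the values allowed at [v] lie between the left and the right slopes *)
  pose L := [set z | exists (x : X) (r s : R), [/\ A (x, r), 0 < s &
                       z = (r - phi (x - s *: v)) / s]].
  have Lle x r t : A (x, r) -> 0 < t -> ubound L ((phi (x + t *: v) - r) / t).
    move=> Ax t0 _ [x' [r' [s [Ax' s0 ->]]]].
    rewrite ler_pdivrMr // mulrAC ler_pdivlMr // mulrBl mulrBl.
    have st0 : 0 < s + t by exact: addr_gt0.
    pose a := t / (s + t).
    have a01 : 0 <= a <= 1.
      rewrite /a divr_ge0 ?(ltW t0) ?(ltW st0) //=.
      by rewrite ler_pdivrMr // mul1r lerDr ltW.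
    have a1 : 1 - a = s / (s + t).
      by rewrite /a; field; rewrite gt_eqF.
    have Aa : A (a *: x' + (1 - a) *: x, a * r' + (1 - a) * r).
      exact: Alin _ _ _ Ax' (AZ (1 - a) _ Ax).
    have := le_trans (Aphi _ Aa) (_ : _ <= a * phi (x' - s *: v) + (1 - a) * phi (x + t *: v)).
    have -> : a *: x' + (1 - a) *: x =
              a *: (x' - s *: v) + (1 - a) *: (x + t *: v).
      rewrite scalerBr scalerDr !scalerA.
      have -> : (1 - a) * t = a * s by rewrite a1 /a; field; rewrite gt_eqF.
      by rewrite addrACA addNr addr0.
    move=> /(_ (cphi _ _ _ a01)) /=.
    rewrite a1 /a -subr_ge0.
    have -> : t / (s + t) * phi (x' - s *: v) + s / (s + t) * phi (x + t *: v) -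
      (t / (s + t) * r' + s / (s + t) * r) =
      (t * phi (x' - s *: v) + s * phi (x + t *: v) - t * r' - s * r) / (s + t).
      by field; rewrite gt_eqF.
    rewrite pmulr_lge0 ?invr_gt0 // => h.
    by lra.
  pose c := sup L.
  have L0 : L !=set0.
    by exists ((0 - phi (0 - 1 *: v)) / 1), 0, 0, 1; split.
  have Lub : has_ubound L.
    by exists ((phi (0 + 1 *: v) - 0) / 1); exact: Lle.
  have cge x r s : A (x, r) -> 0 < s -> r - s * c <= phi (x - s *: v).
    move=> Ax s0.
    have : (r - phi (x - s *: v)) / s <= c.
      by apply: ub_le_sup => //; exists x, r, s.
    by rewrite ler_pdivrMr // => h; lra.
  have cle x r s : A (x, r) -> 0 < s -> r + s * c <= phi (x + s *: v).
    move=> Ax s0.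
    have : c <= (phi (x + s *: v) - r) / s.
      by apply: ge_sup => //; exact: Lle.
    by rewrite ler_pdivlMr // => h; lra.
  pose B := [set w | exists u t, A u /\ w = u + t *: ((v, c) : X * R^o)].
  apply: (Amax B).
    split.
      by move=> u Au; exists u, 0; rewrite scale0r addr0.
    move=> BA; apply: (vA c); apply: BA.
    by exists (0, 0), 1; rewrite scale1r add0r.
  split.
    move=> a _ _ [u [s [Au ->]]] [w [t [Aw ->]]].
    exists (a *: u + w), (a * s + t); split; first exact: Alin.
    by rewrite scalerDr scalerDl scalerA addrACA.
  move=> _ [[x r] [t [Au ->]]] /=.
  have [t0|t0|->] := ltgtP t 0.
  - have := @cge x r (- t) Au; rewrite oppr_gt0 => /(_ t0).
    by rewrite scaleNr opprK mulNr opprK.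
  - exact: cle.
  - by rewrite !scale0r !addr0; exact: (Aphi (x, r)).
have [f fA] := choice Atot.
have flin : linear (f : X -> R^o).
  move=> a x y; apply: (Afun (a *: x + y)); first exact: fA.
  exact: (Alin a _ _ (fA x) (fA y)).
pose xi : {linear X -> R^o} :=
  HB.pack (f : X -> R^o) (GRing.isLinear.Build _ _ _ _ _ flin).
exists xi => x.
exact: (Aphi (x, f x)).
Qed.

Lemma norming_functional (R : realType) (V : normedModType R) (v : V) :
  exists xi : {linear V -> R^o}, xi v = `|v| /\ forall x, `|xi x| <= `|x|.
Proof.
have [|| xi xile] := @convex_dominates_linear R V (fun d => `|v + d| - `|v|).
- move=> x y a /andP[a0 a1].
  have -> : v + (a *: x + (1 - a) *: y) =
            a *: (v + x) + (1 - a) *: (v + y).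
    by rewrite !scalerDr addrACA -scalerDl (addrC a) subrK scale1r.
  have := ler_normD (a *: (v + x)) ((1 - a) *: (v + y)).
  rewrite !normrZ (ger0_norm a0) (@ger0_norm _ (1 - a)) ?subr_ge0 // => h.
  by lra.
- by rewrite addr0 subrr.
have xin x : xi x <= `|x|.
  apply: le_trans (xile x) _.
  by rewrite lerBlDl; exact: ler_normD.
have xinn x : `|xi x| <= `|x|.
  by rewrite ler_norml xin andbT lerNl -raddfN -normrN xin.
exists xi; split => //; apply/eqP; rewrite eq_le xin /=.
by have := xile (- v); rewrite subrr normr0 raddfN add0r lerN2.
Qed.

Lemma linear_le_norm_continuous (R : realType) (V : normedModType R)
    (xi : {linear V -> R^o}) (M : R) :
  (forall x, xi x <= M * `|x|) -> continuous (xi : V -> R^o).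
Proof.
move=> xiM; apply: bounded_linear_continuous; apply/linear_boundedP.
apply: filterS (nbhs_pinfty_ge (num_real M)) => r Mr x.
have h y : xi y <= r * `|y|.
  by apply: le_trans (xiM y) _; rewrite ler_wpM2r.
by rewrite ler_norml h andbT lerNl -raddfN -normrN h.
Qed.

(** Fermat's rule together with the subdifferential sum rule for [h + M |. - w|]:
    the functional dominated by the infimal convolution of the two summands is
    a subgradient of both. *)
Lemma subgradient_sum_norm (R : realType) (V : normedModType R) (D : set V)
    (h : V -> R) (M : R) (u w : V) :
  0 <= M -> D u ->
  (forall x y (a : R), D x -> D y -> 0 <= a <= 1 -> D (a *: x + (1 - a) *: y) /\
     h (a *: x + (1 - a) *: y) <= a * h x + (1 - a) * h y) ->
  (forall v, D v -> h u + M * `|u - w| <= h v + M * `|v - w|) ->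
  exists xi : {linear V -> R^o},
    (forall v, D v -> h u + xi (v - u) <= h v) /\
    (forall v, M * `|u - w| <= M * `|v - w| + xi (v - u)).
Proof.
move=> M0 Du ch umin.
pose S d := [set z | exists v, D v /\ z = h v + M * `|v - d - w|].
pose m := h u + M * `|u - w|.
have Slb d : lbound (S d) (m - M * `|d|).
  move=> _ [v [Dv ->]]; have := umin v Dv.
  have : `|v - w| <= `|v - d - w| + `|d|.
    by apply: le_trans (ler_normD _ _); rewrite addrAC subrK.
  move=> /(ler_wpM2l M0); rewrite /m mulrDr => h1 h2; lra.
have Sinf d : has_inf (S d).
  split; last by exists (m - M * `|d|).
  by exists (h u + M * `|u - d - w|), u.
have infle d v : D v -> inf (S d) <= h v + M * `|v - d - w|.
  by move=> Dv; apply: ge_inf; [case: (Sinf d)|exists v].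
have [|| xi xile] := @convex_dominates_linear R V (fun d => inf (S d) - m).
- move=> x y a /andP[a0 a1].
  have a1' : 0 <= 1 - a by rewrite subr_ge0.
  suff : inf (S (a *: x + (1 - a) *: y)) <=
         a * inf (S x) + (1 - a) * inf (S y) by move=> ?; lra.
  apply/ler_addgt0Pr => e e0.
  have [_ [v1 [Dv1 ->]] h1] := inf_adherent e0 (Sinf x).
  have [_ [v2 [Dv2 ->]] h2] := inf_adherent e0 (Sinf y).
  have [Dv hv] := ch v1 v2 a Dv1 Dv2 (introT andP (conj a0 a1)).
  apply: le_trans (infle _ _ Dv) _.
  have -> : a *: v1 + (1 - a) *: v2 - (a *: x + (1 - a) *: y) - w =
            a *: (v1 - x - w) + (1 - a) *: (v2 - y - w).
    rewrite !scalerBr opprD addrACA.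
    rewrite [RHS]addrACA -opprD -[in LHS](scale1r w).
    by rewrite -scalerDl (addrC a (1 - a)) subrK.
  have := ler_normD (a *: (v1 - x - w)) ((1 - a) *: (v2 - y - w)).
  rewrite !normrZ (ger0_norm a0) (ger0_norm a1') => /(ler_wpM2l M0) h3.
  have := ler_wpM2l a0 (ltW h1); have := ler_wpM2l a1' (ltW h2).
  by lra.
- rewrite subr_ge0; apply: lb_le_inf; first by case: (Sinf 0).
  by have := Slb 0; rewrite normr0 mulr0 subr0.
exists xi; split.
  move=> v Dv.
  have := le_trans (xile (v - u)) (lerB (infle (v - u) v Dv) (lexx m)).
  by rewrite opprB addrCA subrr addr0 /m; lra.
move=> v.
have := le_trans (xile (u - v)) (lerB (infle (u - v) u Du) (lexx m)).
rewrite opprB addrCA subrr addr0 -(opprB v u) raddfN /= /m; lra.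
Qed.

(** * Bounds for continuous linear maps *)

Lemma continuous_linear_norm_bound (R : realType) (V W : normedModType R)
    (f : {linear V -> W}) :
  continuous f -> exists2 B : R, 0 <= B & forall x, `|f x| <= B * `|x|.
Proof.
move=> /(_ 0)/continuous_linear_bounded/linear_boundedP h.
have [B [B0 Bf]] := pinfty_ex_gt0 h.
by exists B => //; exact: ltW.
Qed.

Lemma opnorm_ge (R : realType) (V W : normedModType R)
    (f : {linear V -> W}) x :
  continuous f -> `|f x| <= opnorm f * `|x|.
Proof.
move=> /continuous_linear_norm_bound [B B0 fB].
have [->|x0] := eqVneq x 0; first by rewrite raddf0 !normr0 mulr0.
have nx0 : 0 < `|x| by rewrite normr_gt0.
rewrite -ler_pdivrMr //.
have -> : `|f x| / `|x| = `|f (`|x|^-1 *: x)|.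
  by rewrite linearZ /= normrZ normfV normr_id mulrC.
apply: ub_le_sup.
  exists B => _ [z /= z1 <-].
  by apply: le_trans (fB z) _; rewrite ler_piMr.
exists (`|x|^-1 *: x) => //=.
by rewrite normrZ normfV normr_id mulVf // gt_eqF.
Qed.

Lemma opnorm_ge0 (R : realType) (V W : normedModType R) (f : {linear V -> W}) :
  continuous f -> 0 <= opnorm f.
Proof.
move=> /continuous_linear_norm_bound [B B0 fB].
apply: ub_le_sup; last by exists 0; rewrite /= ?normr0 // raddf0 normr0.
exists B => _ [z /= z1 <-].
by apply: le_trans (fB z) _; rewrite ler_piMr.
Qed.

(** * Subgradients of uniformly convex functions *)

(** A function that is uniformly convex of power type, lower semicontinuous and
    bounded below attains its infimum: a minimizing sequence is Cauchy.  Here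
    [D] stands for the effective domain of the extended-valued function that
    equals [h] on [D]. *)
Lemma uniformly_convex_attains_min (R : realType) (V : completeNormedModType R)
    (D : set V) (h : V -> R) (c p m0 : R) :
  0 < c -> 0 < p -> D !=set0 ->
  (forall x y, D x -> D y -> D (2^-1 *: x + 2^-1 *: y) /\
     h (2^-1 *: x + 2^-1 *: y) + c * `|x - y| `^ p <= 2^-1 * (h x + h y)) ->
  (forall x a, (D x -> a < h x) -> \forall z \near x, D z -> a < h z) ->
  (forall x, D x -> m0 <= h x) ->
  exists2 u, D u & forall v, D v -> h u <= h v.
Proof.
move=> c0 p0 [x0 Dx0] ch lsch lbh.
pose S := [set h v | v in D].
have Sinf : has_inf S.
  split; first by exists (h x0), x0.
  by exists m0 => _ [v Dv <-]; exact: lbh.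
pose m := inf S.
have mle v : D v -> m <= h v.
  by move=> Dv; apply: ge_inf; [case: Sinf|exists v].
have /choice[u uP] (n : nat) : exists v, D v /\ h v < m + n.+1%:R^-1.
  have n0 : 0 < n.+1%:R^-1 :> R by rewrite invr_gt0.
  by have [_ [v Dv <-] ?] := inf_adherent n0 Sinf; exists v.
have invle (i n : nat) : (n <= i)%N -> i.+1%:R^-1 <= n.+1%:R^-1 :> R.
  by move=> ni; rewrite lef_pV2 ?posrE ?ltr0n // ler_nat ltnS.
have small (e : R) : 0 < e -> exists n : nat, n.+1%:R^-1 < e.
  move=> e0; have [n _ ne] := near_infty_natSinv_lt (PosNum e0).
  by exists n; exact: (ne n (leqnn n)).
have cu : cvg (u @ \oo).
  apply: cauchy_cvg; apply: cauchy_exP => e e0.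
  have [n ne] : exists n : nat, n.+1%:R^-1 < c * e `^ p.
    by apply: small; rewrite mulr_gt0 // powR_gt0.
  exists (u n); exists n => // i /= ni.
  rewrite -ball_normE /=.
  have [Dm hm] := ch _ _ (uP n).1 (uP i).1.
  have := mle _ Dm; have := (uP n).2; have := (uP i).2; have := invle _ _ ni.
  move=> h1 h2 h3 h4.
  rewrite ltNge; apply/negP => /(ge0_ler_powR (ltW p0)).
  rewrite !nnegrE (ltW e0) normr_ge0 => /(_ isT isT).
  rewrite -(ler_pM2l c0) => h5.
  move: hm h1 h2 h3 h4 h5 ne; move: (n.+1%:R^-1) (i.+1%:R^-1) => a b.
  by lra.
pose x := lim (u @ \oo).
have key a : (D x -> a < h x) -> a <= m.
  move=> /lsch /cu [k _ kP]; apply/ler_addgt0Pr => e /small [n ne].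
  pose i := maxn k n.
  have [Di hi] := uP i.
  have := kP i (leq_maxl _ _) Di; have := invle _ _ (leq_maxr k n).
  rewrite -/i; move: hi ne; move: (n.+1%:R^-1) (i.+1%:R^-1) => b d.
  by lra.
have Dx : D x.
  apply: contrapT => nDx.
  by have := key (m + 1) (fun Dx => False_ind _ (nDx Dx)); lra.
exists x => // v Dv; apply: le_trans (mle _ Dv).
apply/ler_addgt0Pr => e e0; rewrite -lerBlDr; apply: key => _.
by rewrite ltrBlDr ltrDl.
Qed.

Lemma proper_fineK (R : realType) (T : normedModType R) (Theta : T -> \bar R) x :
  proper_function Theta -> (Theta x < +oo)%E -> (fine (Theta x))%:E = Theta x.
Proof. by move=> [pT _] Tx; rewrite fineK // fin_numE pT lt_eqF. Qed.

Lemma p_convex_fine (R : realType) (T : normedModType R) (Theta : T -> \bar R)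
    (p : R) :
  proper_function Theta -> p_convex p Theta ->
  exists2 C0 : R, 0 < C0 &
  forall x y (a : R), (Theta x < +oo)%E -> (Theta y < +oo)%E -> 0 <= a <= 1 ->
   (Theta (a *: x + (1 - a) *: y)%R < +oo)%E /\
   fine (Theta (a *: x + (1 - a) *: y)) + C0 * a * (1 - a) * `|x - y| `^ p
     <= a * fine (Theta x) + (1 - a) * fine (Theta y).
Proof.
move=> pT [C0 C00 cT]; exists C0 => // x y a Dx Dy /andP[a0 a1].
have [->|an0] := eqVneq a 0.
  rewrite scale0r add0r subr0 scale1r; split => //.
  by rewrite mulr0 !mul0r addr0 add0r mul1r.
have [->|an1] := eqVneq a 1.
  rewrite subrr scale0r addr0 scale1r; split => //.
  by rewrite mulr0 !mul0r !addr0 mul1r.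
have a01 : 0 < a < 1 by rewrite !lt_def an0 a0 eq_sym an1 a1.
have := cT y x a a01.
rewrite -(proper_fineK _ _ _ _ pT Dx) -(proper_fineK _ _ _ _ pT Dy).
set w := a *: x + _.
rewrite -!EFinM -EFinD => le.
have Dw : (Theta w < +oo)%E.
  rewrite ltey; apply/eqP => Tw; move: le.
  by rewrite Tw addye // leye_eq.
by split => //; move: le; rewrite -(proper_fineK _ _ _ _ pT Dw) -EFinD lee_fin.
Qed.

Lemma subdifferential_fine (R : realType) (T : normedModType R)
    (Theta : T -> \bar R) (x : T) (xi : {linear T -> R^o}) :
  proper_function Theta -> (Theta x < +oo)%E ->
  (forall z, 0 <= bregman Theta xi z x)%E <->
  (forall z, (Theta z < +oo)%E ->
     fine (Theta x) + xi (z - x) <= fine (Theta z)).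
Proof.
move=> pT Dx; split=> [h z Dz|h z].
  have := h z; rewrite /bregman.
  rewrite -(proper_fineK _ _ _ _ pT Dx) -(proper_fineK _ _ _ _ pT Dz).
  by rewrite -!EFinB lee_fin /=; lra.
rewrite /bregman -(proper_fineK _ _ _ _ pT Dx).
have [Dz|] := ltP (Theta z) +oo%E.
  rewrite -(proper_fineK _ _ _ _ pT Dz) -!EFinB lee_fin.
  by have := h z Dz; lra.
by rewrite leye_eq => /eqP ->; exact: leey.
Qed.

(** A Brondsted-Rockafellar type statement: points carrying a subgradient
    approximate any point [w] of the effective domain, in norm and, from below,
    in value, and the subgradients can be taken nonnegative in the direction of
    [w].  Such points minimize [Theta + M |. - w|] for large [M]. *)
Lemma subgradient_approx (R : realType) (X : completeNormedModType R)
    (Theta : X -> \bar R) (p : R) (xbar w : X) (e : R) :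
  0 < p -> proper_function Theta -> lower_semicontinuous Theta ->
  p_convex p Theta -> dom_subdifferential Theta xbar ->
  (Theta w < +oo)%E -> 0 < e ->
  exists u (xi : {linear X -> R^o}),
    [/\ (Theta u < +oo)%E, subdifferential Theta u xi, `|u - w| < e,
        fine (Theta w) - e < fine (Theta u) & 0 <= xi (w - u)].
Proof.
move=> p0 pT lT pcT [Dxbar [zeta [zetac /subdifferential_fine zetas]]] Dw e0.
have {}zetas := zetas pT Dxbar.
have [C0 C00 cT] := p_convex_fine _ _ _ _ pT pcT.
pose D := [set x | (Theta x < +oo)%E].
pose h x := fine (Theta x).
have hE x : D x -> Theta x = (h x)%:E by move=> Dx; rewrite proper_fineK.
have lh x a : (D x -> a < h x) -> \forall z \near x, D z -> a < h z.
  move=> ax; have /lT [V xV Va] : (a%:E < Theta x)%E.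
    have [Dx|] := ltP (Theta x) +oo%E; first by rewrite hE // lte_fin ax.
    by rewrite leye_eq => /eqP ->; exact: ltry.
  apply: filterS xV => z /Va + Dz.
  by rewrite hE // lte_fin.
have [B B0 zB] := continuous_linear_norm_bound _ _ _ _ zetac.
(* an affine minorant makes [h + M |. - w|] bounded below once [M >= B] *)
pose A : R := `|h xbar| + B * `|w - xbar|.
have lbh v : D v -> - A - B * `|v - w| <= h v.
  move=> /zetas; rewrite -/(h xbar) -/(h v).
  have := zB (v - xbar); rewrite ler_norml => /andP[+ _].
  have : `|v - xbar| <= `|v - w| + `|w - xbar|.
    by apply: le_trans (ler_normD _ _); rewrite addrA subrK.
  move=> /(ler_wpM2l B0).
  have := ler_norm (- h xbar); rewrite normrN /A; lra.
have /nbhs_ballP [d /= d0 dP] : \forall z \near w, D z -> h w - e < h z.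
  by apply: lh => _; rewrite ltrBlDr ltrDl.
pose r : R := Num.min e d.
have r0 : 0 < r by rewrite lt_min e0 d0.
have hwA : 0 <= h w + A.
  by have := lbh w Dw; rewrite subrr normr0 mulr0; lra.
(* for this [M] a minimizer lies within [r] of [w] *)
pose M : R := B + (h w + A + 1) / r.
have MB : 0 < M - B.
  by rewrite /M addrAC subrr add0r divr_gt0 // ltr_wpDl.
have M0 : 0 <= M by lra.
pose g v := h v + M * `|v - w|.
have c0 : 0 < C0 * 2^-1 * 2^-1 by rewrite !mulr_gt0 // invr_gt0.
have [|x y Dx Dy|x a ag|x Dx|u Du umin] :=
    @uniformly_convex_attains_min R X D g (C0 * 2^-1 * 2^-1) p (- A) c0 p0.
- by exists w.
- have a01 : 0 <= (2^-1 : R) <= 1 by lra.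
  have := cT x y 2^-1 Dx Dy a01.
  have -> : 1 - (2^-1 : R) = 2^-1 by lra.
  move=> [Dm hm]; split => //; rewrite /g.
  have -> : 2^-1 *: x + 2^-1 *: y - w = 2^-1 *: (x - w) + 2^-1 *: (y - w).
    rewrite !scalerBr addrACA -opprD -scalerDl.
    by have -> : (2^-1 : R) + 2^-1 = 1; [lra|rewrite scale1r].
  have := ler_normD (2^-1 *: (x - w)) (2^-1 *: (y - w)).
  rewrite !normrZ (@ger0_norm _ 2^-1) ?invr_ge0 // => /(ler_wpM2l M0).
  by move: hm; rewrite -/(h x) -/(h y) -/(h (2^-1 *: x + 2^-1 *: y)); lra.
- (* the norm term is continuous, so [g] is lower semicontinuous like [h] *)
  have [s s0 sP] : exists2 s, 0 < s & D x -> a - M * `|x - w| + s < h x.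
    have [Dx|nDx] := pselect (D x); last by exists 1.
    exists ((g x - a) / 2); first by have := ag Dx; lra.
    by have := ag Dx; rewrite /g; lra.
  have h1 := lh _ _ sP.
  have h2 : \forall z \near x, M * `|x - z| < s.
    have s1 : 0 < s / (M + 1) by rewrite divr_gt0 // ltr_wpDl.
    apply/nbhs_ballP; exists (s / (M + 1)) => //= z.
    rewrite -ball_normE /= ltr_pdivlMr ?ltr_wpDl // => h2.
    by apply: le_lt_trans h2; rewrite mulrC ler_wpM2l // lerDl.
  apply: filterS2 h1 h2 => z h1 h2 Dz; have := h1 Dz; rewrite /g.
  have : `|x - w| <= `|x - z| + `|z - w|.
    by apply: le_trans (ler_normD _ _); rewrite addrA subrK.
  by move=> /(ler_wpM2l M0); lra.
- rewrite /g; have := lbh x Dx.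
  by have := mulr_ge0 (ltW MB) (normr_ge0 (x - w)); lra.
have uw : `|u - w| < r.
  have := umin w Dw; rewrite /g subrr normr0 mulr0 addr0 => h1.
  have h2 := lbh u Du.
  have h3 : (M - B) * `|u - w| < (M - B) * r.
    have -> : (M - B) * r = h w + A + 1.
      by rewrite /M addrAC subrr add0r divfK ?gt_eqF.
    by move: h1 h2; rewrite mulrBl; lra.
  by move: h3; rewrite ltr_pM2l.
have cD x y (a : R) : D x -> D y -> 0 <= a <= 1 -> D (a *: x + (1 - a) *: y) /\
     h (a *: x + (1 - a) *: y) <= a * h x + (1 - a) * h y.
  move=> Dx Dy a01; have [Dm hm] := cT x y a Dx Dy a01; split => //.
  apply: le_trans hm; rewrite lerDl.
  by case/andP: a01 => a0 a1; rewrite !mulr_ge0 ?powR_ge0 ?subr_ge0 // ltW.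
have [xi [xi1 xi2]] := subgradient_sum_norm _ _ _ _ _ _ _ M0 Du cD umin.
exists u, xi; split => //.
- split; last by apply/subdifferential_fine => //.
  apply: (@linear_le_norm_continuous _ _ _ M) => x.
  have := xi2 (u - x); rewrite addrAC (addrC u (- x)) addrK raddfN /=.
  by have := ler_normB (u - w) x => /(ler_wpM2l M0); rewrite mulrDr; lra.
- by apply: lt_le_trans uw _; rewrite ge_min lexx.
- apply: dP => //; rewrite -ball_normE /= distrC.
  by apply: lt_le_trans uw _; rewrite ge_min lexx orbT.
- have := xi2 w; rewrite subrr normr0 mulr0 add0r; apply: le_trans.
  by rewrite mulr_ge0.
Qed.

(** The constant [gamma] is inherited by the restriction of [Theta] to a convex
    set.  This is not immediate, since a subgradient of the restriction need not
    be one of [Theta]; the inequality is applied to subgradients of [Theta] near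
    points of the segment from [x] to [z] that approach [x]. *)
Lemma bregman_restrict_ge (R : realType) (X : completeNormedModType R)
    (Theta : X -> \bar R) (p gamma : R) (DF : set X) (xbar x z : X)
    (xi : {linear X -> R^o}) :
  0 < p -> proper_function Theta -> lower_semicontinuous Theta ->
  p_convex p Theta -> bregman_constant p gamma Theta ->
  dom_subdifferential Theta xbar ->
  (forall u v (a : R), DF u -> DF v -> 0 <= a <= 1 -> DF (a *: u + (1 - a) *: v)) ->
  DF x -> (Theta x < +oo)%E -> DF z -> (Theta z < +oo)%E ->
  (forall v, DF v -> (Theta v < +oo)%E ->
     fine (Theta x) + xi (v - x) <= fine (Theta v)) ->
  `|z - x| `^ p <=
    gamma `^ p * (fine (Theta z) - fine (Theta x) - xi (z - x)).
Proof.
move=> p0 pT lT pcT [g0 gT] Dxbar cDF DFx Dx DFz Dz xis.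
have [C0 C00 cT] := p_convex_fine _ _ _ _ pT pcT.
pose h x := fine (Theta x).
set Delta := fine (Theta z) - _ - _.
have gp0 : 0 < gamma `^ p by rewrite powR_gt0.
suff key (b : R) : 0 <= b < `|z - x| -> b `^ p <= gamma `^ p * Delta.
  have De0 : 0 <= gamma `^ p * Delta.
    by rewrite mulr_ge0 ?(ltW gp0) // /Delta; have := xis z DFz Dz; lra.
  rewrite leNgt; apply/negP => lt1.
  pose b : R := (gamma `^ p * Delta) `^ p^-1.
  have bp : b `^ p = gamma `^ p * Delta.
    by rewrite /b -powRrM mulVf ?gt_eqF // powRr1.
  have bz : b < `|z - x|.
    rewrite ltNge; apply/negP => /(ge0_ler_powR (ltW p0)).
    rewrite !nnegrE normr_ge0 powR_ge0 => /(_ isT isT).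
    by rewrite bp leNgt lt1.
  have b0 : 0 <= b by exact: powR_ge0.
  have : ((b + `|z - x|) / 2) `^ p <= gamma `^ p * Delta.
    by apply: key; apply/andP; split; lra.
  rewrite -bp leNgt => /negP; apply; by apply: gt0_ltr_powR => //; rewrite ?nnegrE; lra.
move=> /andP[b0 bz].
have zx0 : 0 < `|z - x| by exact: le_lt_trans b0 bz.
pose a : R := (1 - b / `|z - x|) / 2.
have bzx : b / `|z - x| < 1 by rewrite ltr_pdivrMr // mul1r.
have bzx0 : 0 <= b / `|z - x| by rewrite divr_ge0.
have a0 : 0 < a by rewrite /a; lra.
have a1 : a <= 1 by rewrite /a; lra.
have ab : b < (1 - a) * `|z - x|.
  by rewrite -ltr_pdivrMr // /a; lra.
have a01 : 0 <= a <= 1 by rewrite (ltW a0) a1.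
pose w := a *: z + (1 - a) *: x.
have [Dw hw] := cT z x a Dz Dx a01.
have DFw : DF w by exact: cDF.
have zw : z - w = (1 - a) *: (z - x).
  by rewrite /w scalerBr opprD addrA -[X in X - _ *: z](scale1r z) -scalerBl.
have wx : w - x = a *: (z - x).
  rewrite /w -addrA scalerBr; congr (_ + _).
  by rewrite -[X in _ - X](scale1r x) -scalerBl addrAC subrr add0r scaleNr.
have nzw : `|z - w| = (1 - a) * `|z - x|.
  by rewrite zw normrZ ger0_norm // subr_ge0.
suff main (e : R) : 0 < e -> e <= `|z - w| - b ->
    gamma `^ p * (h w - e) + a * b `^ p <=
    gamma `^ p * (a * h z + (1 - a) * h x).
  have : a * b `^ p <= gamma `^ p * (a * Delta).
    apply/ler_addgt0Pr => s s0.
    pose e : R := Num.min (s / gamma `^ p) (`|z - w| - b).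
    have e0 : 0 < e by rewrite lt_min divr_gt0 //= subr_gt0 nzw.
    have eb : e <= `|z - w| - b by rewrite ge_min lexx orbT.
    have es : gamma `^ p * e <= s.
      by rewrite mulrC -ler_pdivlMr // ge_min lexx.
    have := main e e0 eb.
    have := xis w DFw Dw; rewrite wx linearZ /=.
    move=> /(ler_wpM2l (ltW gp0)); rewrite -/(h w) -/(h x) /Delta -/(h z) -/(h x).
    rewrite /GRing.scale /=; lra.
  by rewrite mulrCA ler_pM2l.
move=> e0 eb.
have [u [eta [Du etas uw hu etaw]]] :=
  @subgradient_approx _ _ Theta p xbar w e p0 pT lT pcT Dxbar Dw e0.
have [/(_ etas.2) etas' _] := subdifferential_fine _ _ _ _ eta pT Du.
have Du' : dom_subdifferential Theta u by split => //; exists eta.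
have := gT z u eta Du' etas.
rewrite /bregman -(proper_fineK _ _ _ _ pT Dz) -(proper_fineK _ _ _ _ pT Du).
rewrite -!EFinB poweR_EFin -EFinM lee_fin -/(h z) -/(h u).
set br := h z - h u - _ => zu.
have br0 : 0 <= br by have := etas' z Dz; rewrite /br /h; lra.
have bzu : b <= `|z - u|.
  have := ler_normD (z - u) (u - w); rewrite addrA subrK; lra.
have : b `^ p <= gamma `^ p * br.
  have <- : (gamma * br `^ p^-1) `^ p = gamma `^ p * br.
    rewrite powRM ?(ltW g0) ?powR_ge0 //.
    by rewrite -powRrM mulVf ?gt_eqF // powRr1.
  have h1 := le_trans bzu zu.
  by apply: ge0_ler_powR; rewrite ?nnegrE ?(ltW p0) // (le_trans b0 h1).
(* in the convex combination of the subgradient inequalities at [z] and at [x]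
   the linear terms add up to [eta (w - u)], which is nonnegative *)
have etax := etas' x Dx; rewrite -/(h u) -/(h x) in etax.
have etasum : a * eta (z - u) + (1 - a) * eta (x - u) = eta (w - u).
  have -> : w - u = a *: (z - u) + (1 - a) *: (x - u).
    rewrite /w !scalerBr addrACA -opprD -scalerDl (addrC a) subrK.
    by rewrite scale1r.
  by rewrite [in RHS]linearD !linearZ.
move=> /(ler_wpM2l (ltW a0)).
have a1' : 0 <= 1 - a by rewrite subr_ge0.
have := ler_wpM2l a1' etax.
have := hu; rewrite -/(h w) -/(h u) => hu'.
move=> h1 h2.
have h3 : h w - e + a * br <= a * h z + (1 - a) * h x.
  by move: h1; rewrite /br; move: etasum etaw hu'; lra.
have := ler_wpM2l (ltW gp0) h3.
by rewrite mulrDr; lra.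
Qed.

(** * Linearization error *)

Lemma convex_set_combination (R : realType) (V : normedModType R)
    (A : set V) (u v : V) (a : R) :
  convex_set (A : set (convex_lmodType V)) -> A u -> A v -> 0 <= a <= 1 ->
  A (a *: u + (1 - a) *: v).
Proof.
move=> cA Au Av /andP[a0 a1].
have := cA u v (Itv01 a0 a1) (mem_set Au) (mem_set Av).
by move/set_mem.
Qed.

(** Mean value inequality on the unit interval for a curve that is
    differentiable there, one-sidedly at the end points.  A norming functional
    reduces it to the scalar mean value theorem. *)
Lemma mean_value_norm (R : realType) (W : normedModType R) (G G' : R -> W)
    (M : R) :
  (forall t e : R, 0 <= t <= 1 -> 0 < e -> exists2 d : R, 0 < d &
     forall h : R, `|h| < d -> 0 <= t + h <= 1 ->
       `|G (t + h) - G t - h *: G' t| <= e * `|h|) ->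
  (forall t : R, 0 < t < 1 -> `|G' t| <= M) ->
  `|G 1 - G 0| <= M.
Proof.
move=> dG G'M.
have [xi [xiv xile]] := norming_functional R W (G 1 - G 0).
pose f t : R := xi (G t); pose df t : R := xi (G' t).
have fE (t e : R) : 0 <= t <= 1 -> 0 < e -> exists2 d : R, 0 < d &
    forall h : R, `|h| < d -> 0 <= t + h <= 1 ->
      `|f (t + h) - f t - h * df t| <= e * `|h|.
  move=> t01 e0; have [d d0 dP] := dG t e t01 e0; exists d => // h hd th.
  have <- : xi (G (t + h) - G t - h *: G' t) = f (t + h) - f t - h * df t.
    by rewrite 2!(raddfB xi) /= [in LHS]linearZ.
  exact: le_trans (xile _) (dP h hd th).
have fd (t : R) : t \in `]0, 1[ -> is_derive t (1 : R) (f : R -> R) (df t).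
  rewrite in_itv /= => /andP[t0 t1].
  have lim_f : h^-1 *: ((f \o shift t) (h *: (1 : R)) - f t) @[h --> (0 : R)^']
      --> df t.
    apply/cvgrPdist_le => e e0.
    have t01 : 0 <= t <= 1 by rewrite !ltW.
    have [d d0 dP] := fE t e t01 e0.
    have m0 : 0 < Num.min d (Num.min t (1 - t)).
      by rewrite !lt_min d0 t0 subr_gt0.
    have h0 : \forall h \near (0 : R)^', h != 0 by exact: nbhs_dnbhs_neq.
    have hm : \forall h \near (0 : R)^', `|h| < Num.min d (Num.min t (1 - t)).
      exact: dnbhs0_lt.
    apply: filterS2 h0 hm => h h0.
    rewrite !lt_min => /andP[hd /andP[ht ht1]].
    have th : 0 <= t + h <= 1.
      move: ht ht1; rewrite !ltr_norml => /andP[? _] /andP[_ ?].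
      by apply/andP; split; lra.
    have := dP h hd th.
    have -> : f (t + h) - f t - h * df t =
        - (h * (df t - h^-1 * (f (t + h) - f t))).
      by rewrite mulrBr mulVKf // opprB.
    rewrite normrN normrM mulrC ler_pM2r ?normr_gt0 //.
    by rewrite /= /GRing.scale /= mulr1 (addrC h).
  split; first by apply/cvg_ex; exists (df t).
  exact: (cvg_lim _ lim_f).
have fc : {within `[0, 1], continuous (f : R -> R)}.
  apply/subspace_continuousP => t /=; rewrite in_itv /= => t01.
  apply/cvgrPdist_le => e e0.
  rewrite near_withinE.
  have [d d0 dP] := fE t 1 t01 ltr01.
  have c0 : 0 < 1 + `|df t| by rewrite ltr_pwDl.
  have m0 : 0 < Num.min d (e / (1 + `|df t|)) by rewrite lt_min d0 divr_gt0.
  apply/nbhs_ballP; exists (Num.min d (e / (1 + `|df t|))) => //= s.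
  rewrite -ball_normE /= distrC lt_min => /andP[sd se].
  rewrite in_itv /= => s01.
  have := dP (s - t) sd; rewrite addrC subrK => /(_ s01).
  set q := s - t in sd se *.
  move=> h1; rewrite distrC.
  have h2 : `|f s - f t| <= `|f s - f t - q * df t| + `|q| * `|df t|.
    by rewrite -normrM; apply: le_trans (ler_normD _ _); rewrite subrK.
  move: se; rewrite ltr_pdivlMr // => se.
  by move: h1 h2 se; rewrite mulrDr; lra.
have [c c01 fc1] := MVT ltr01 fd fc.
move: c01; rewrite in_itv /= => c01.
rewrite -xiv raddfB /= -/(f 1) -/(f 0) fc1 subr0 mulr1.
apply: le_trans (G'M c c01).
by apply: le_trans (ler_norm _) _; exact: xile.
Qed.

(** Integrating the nonlinearity condition along the segment from [x] to [z]
    bounds the linearization error of [F]. *)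
Lemma linearization_error (R : realType) (X Y : normedModType R)
    (DF : set X) (F : X -> Y) (F' : X -> {linear X -> Y}) (xdag : X)
    (rho K0 K1 : R) (x z : X) :
  convex_set (DF : set (convex_lmodType X)) ->
  directional_derivative DF F F' xdag rho ->
  nonlinearity_condition DF F' xdag rho K0 K1 ->
  0 <= K0 -> 0 <= K1 ->
  DF x -> `|x - xdag| < rho -> DF z -> `|z - xdag| < rho ->
  `|F z - F x - F' x (z - x)| <= (K0 + K1) * `|z - x| * `|F' x (z - x)|.
Proof.
move=> cDF dF nF K00 K10 DFx xr DFz zr.
pose d := z - x.
pose P (t : R) := t *: z + (1 - t) *: x.
have P0 : P 0 = x by rewrite /P scale0r add0r subr0 scale1r.
have P1 : P 1 = z by rewrite /P subrr scale0r addr0 scale1r.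
have PE t : P t = x + t *: d.
  by rewrite /P /d scalerBr scalerBl scale1r addrCA.
have Preg (t : R) : 0 <= t <= 1 -> DF (P t) /\ `|P t - xdag| < rho.
  move=> t01; split; first exact: convex_set_combination.
  have -> : P t - xdag = t *: (z - xdag) + (1 - t) *: (x - xdag).
    rewrite !scalerBr addrACA -opprD -scalerDl (addrC t) subrK.
    by rewrite scale1r.
  apply: le_lt_trans (ler_normD _ _) _; rewrite !normrZ.
  case/andP: t01 => t0 t1; rewrite ger0_norm // ger0_norm ?subr_ge0 //.
  have [->|tn0] := eqVneq t 0; first by rewrite mul0r add0r subr0 mul1r.
  have t0' : 0 < t by rewrite lt_def tn0.
  have : t * `|z - xdag| < t * rho by rewrite ltr_pM2l.
  have : (1 - t) * `|x - xdag| <= (1 - t) * rho.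
    by rewrite ler_wpM2l ?subr_ge0 // ltW.
  lra.
have one_sided u v (e : R) : DF u /\ `|u - xdag| < rho ->
    DF v /\ `|v - xdag| < rho -> 0 < e -> exists2 r : R, 0 < r &
    forall s : R, 0 < s < r ->
      `|F (u + s *: (v - u)) - F u - s *: F' u (v - u)| <= e * s.
  move=> ur vr e0.
  have /cvgrPdist_le/(_ e e0) := (dF u ur).2 v vr.
  move=> [r /= r0 rP]; exists r => // s /andP[s0 sr].
  have := rP s; rewrite /= sub0r normrN gtr0_norm // => /(_ sr s0) h.
  have -> : F (u + s *: (v - u)) - F u - s *: F' u (v - u) =
      - (s *: (F' u (v - u) - s^-1 *: (F (u + s *: (v - u)) - F u))).
    by rewrite [in RHS]scalerBr scalerA mulfV ?gt_eqF // scale1r opprB.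
  by rewrite normrN normrZ gtr0_norm // mulrC ler_pM2r.
pose G t := F (P t) - t *: F' x d.
pose G' t := F' (P t) d - F' x d.
have G10 : G 1 - G 0 = F z - F x - F' x d.
  by rewrite /G P0 P1 scale1r scale0r subr0 addrAC.
rewrite -/d -G10; apply: (@mean_value_norm _ _ G G').
  move=> t e t01 e0; have [t0 t1] := andP t01.
  have zP : z - P t = (1 - t) *: d.
    by rewrite PE opprD addrA -/d scalerBl scale1r.
  have xP : x - P t = (- t) *: d.
    by rewrite PE opprD addrA subrr sub0r scaleNr.
  have G'E (h : R) : G (t + h) - G t - h *: G' t =
      F (P (t + h)) - F (P t) - h *: F' (P t) d.
    rewrite /G /G' scalerDl scalerBr.
    move: (F _) (F _) (t *: _) (h *: _) (h *: _) => B A v1 C v2.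
    rewrite (opprD v1) !opprB (addrA A) (addrAC A) (addrA (A - v2 - v1)) subrK.
    by rewrite (addrAC A (- v2) (- B)) (addrA (A - B - v2)) subrK.
  have [r1 r10 r1P] : exists2 r : R, 0 < r & forall h : R, 0 < h < r ->
      t + h <= 1 -> `|G (t + h) - G t - h *: G' t| <= e * h.
    have [tlt1|] := ltP t 1; last by exists 1 => // h /andP[h0 _]; lra.
    have t1' : 0 < 1 - t by rewrite subr_gt0.
    have [r r0 rP] := one_sided (P t) z (e * (1 - t)) (Preg t t01)
                        (conj DFz zr) (mulr_gt0 e0 t1').
    exists (r * (1 - t)); first exact: mulr_gt0.
    move=> h /andP[h0 hr] th.
    have := rP (h / (1 - t)); rewrite divr_gt0 //= ltr_pdivrMr // => /(_ hr).
    have -> : F' (P t) (z - P t) = (1 - t) *: F' (P t) d.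
      by rewrite zP linearZ.
    rewrite zP !scalerA divfK ?gt_eqF //.
    have -> : P t + h *: d = P (t + h) by rewrite !PE scalerDl addrA.
    by rewrite mulrA mulrAC mulfK ?gt_eqF // G'E.
  have [r2 r20 r2P] : exists2 r : R, 0 < r & forall h : R, 0 < h < r ->
      0 <= t - h -> `|G (t - h) - G t - (- h) *: G' t| <= e * h.
    have [tgt0|] := ltP 0 t; last by exists 1 => // h /andP[h0 _]; lra.
    have [r r0 rP] := one_sided (P t) x (e * t) (Preg t t01)
                        (conj DFx xr) (mulr_gt0 e0 tgt0).
    exists (r * t); first exact: mulr_gt0.
    move=> h /andP[h0 hr] th.
    have := rP (h / t); rewrite divr_gt0 //= ltr_pdivrMr // => /(_ hr).
    have -> : F' (P t) (x - P t) = (- t) *: F' (P t) d.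
      by rewrite xP linearZ.
    rewrite xP !scalerA mulrN divfK ?gt_eqF //.
    have -> : P t + (- h) *: d = P (t - h) by rewrite !PE scalerDl addrA.
    by rewrite mulrA mulrAC mulfK ?gt_eqF // G'E.
  exists (Num.min r1 r2); first by rewrite lt_min r10.
  move=> h; rewrite lt_min => /andP[hr1 hr2] /andP[th0 th1].
  have [h0|h0|->] := ltgtP h 0.
  - have := r2P (- h); rewrite opprK ltr0_norm // in hr2 *.
    by apply => //; rewrite oppr_gt0 h0.
  - have := r1P h; rewrite gtr0_norm // in hr1 *.
    by apply => //; rewrite h0.
  - by rewrite addr0 subrr scale0r subrr !normr0 mulr0.
move=> t /andP[t0 t1]; rewrite /G'.
have t01 : 0 <= t <= 1 by rewrite !ltW.
apply: le_trans (nF _ _ d (conj DFx xr) (Preg t t01)) _.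
have -> : P t - x = t *: d by rewrite PE addrAC subrr add0r.
rewrite linearZ !normrZ gtr0_norm //.
have := mulr_ge0 (normr_ge0 d) (normr_ge0 (F' x d)).
set q := `|d| * _ => q0.
have -> : K0 * (t * `|d|) * `|F' x d| + K1 * (t * `|F' x d|) * `|d| =
  t * ((K0 + K1) * q) by rewrite /q; ring.
have -> : (K0 + K1) * `|d| * `|F' x d| = (K0 + K1) * q by rewrite mulrA.
by apply: ler_piMl; [rewrite mulr_ge0 // addr_ge0|exact: ltW].
Qed.

(** * Inequalities for real powers *)

Lemma powR_le (R : realType) (r x y : R) :
  0 <= r -> 0 <= x -> x <= y -> x `^ r <= y `^ r.
Proof.
move=> r0 x0 xy; apply: ge0_ler_powR => //; rewrite nnegrE //.
exact: le_trans xy.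
Qed.

Lemma powR_le_cancel (R : realType) (r x y : R) :
  0 < r -> 0 <= x -> 0 <= y -> x `^ r <= y `^ r -> x <= y.
Proof.
move=> r0 x0 y0; rewrite !leNgt; apply: contra => yx.
by apply: gt0_ltr_powR.
Qed.

Lemma powRVK (R : realType) (r x : R) : r != 0 -> 0 <= x -> (x `^ r^-1) `^ r = x.
Proof. by move=> r0 x0; rewrite -powRrM mulVf // powRr1. Qed.

Lemma powR_superadd (R : realType) (p a b : R) :
  1 <= p -> 0 <= a -> 0 <= b -> a `^ p + b `^ p <= (a + b) `^ p.
Proof.
move=> p1 a0 b0; have p0 : 0 < p by lra.
have ab0 : 0 <= a + b by rewrite addr_ge0.
have p10 : 0 <= p - 1 by lra.
rewrite -(mulr_powRB1 a0 p0) -(mulr_powRB1 b0 p0) -(mulr_powRB1 ab0 p0).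
rewrite mulrDl lerD // ler_wpM2l // powR_le //.
- by rewrite lerDl.
- by rewrite lerDr.
Qed.

Lemma powR_le_expand (R : realType) (x c : R) : 1 <= c -> 0 < x <= 1 ->
  c `^ x <= c.
Proof.
move=> c1 /andP[x0 x1].
by rewrite -[leRHS](@powRr1 _ c) ?ler_powR //; lra.
Qed.

(** A Young type inequality with an arbitrarily small first term. *)
Lemma powR_young (R : realType) (p k w x : R) :
  2 <= p -> 0 < k <= 1 -> 0 <= w -> 0 <= x ->
  w `^ (p - 1) * x <= (k * x) `^ p + (k ^+ 2)^-1 * w `^ p.
Proof.
move=> p2 /andP[k0 k1] w0 x0.
have k20 : 0 < k ^+ 2 by rewrite exprn_gt0.
have p0 : 0 < p by lra.
have p10 : 0 <= p - 1 by lra.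
have [wx|xw] := leP w (k ^+ 2 * x).
  apply: (@le_trans _ _ ((k * x) `^ p)); last first.
    by rewrite lerDl mulr_ge0 ?powR_ge0 // invr_ge0 ltW.
  apply: (@le_trans _ _ ((k ^+ 2 * x) `^ (p - 1) * x)).
    by rewrite ler_wpM2r // powR_le.
  rewrite (powRM _ (ltW k20) x0) (powRM _ (ltW k0) x0) -mulrA (mulrC _ x) mulr_powRB1 //.
  rewrite ler_wpM2r ?powR_ge0 // -powR_mulrn ?(ltW k0) // -powRrM.
  by apply: ger_powR; [rewrite k0|lra].
have w0' : 0 <= k^-2 * w by rewrite mulr_ge0 // invr_ge0 ltW.
apply: (@le_trans _ _ ((k ^+ 2)^-1 * w `^ p)); last by rewrite lerDr powR_ge0.
rewrite -(mulr_powRB1 w0 p0) mulrA mulrC ler_wpM2r ?powR_ge0 //.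
by rewrite ler_pdivlMl // ltW.
Qed.

(** Two consequences of the energy inequality: the residual [r] exceeds [d] only
    by an arbitrarily small multiple of [t] and by a multiple of [w]; for [v] a
    factor 2 is lost. *)
Lemma energy_step (R : realType) (p k r v t d w : R) :
  2 <= p -> 0 < k <= 1 -> 0 <= r -> 0 <= v -> 0 <= t -> 0 <= d -> 0 <= w ->
  r `^ p + v `^ p <= d `^ p + w `^ (p - 1) * (v + t) ->
  r <= d + k * t + (4 + (k ^+ 2)^-1) * w /\
  v <= 2 * (d + k * t + (4 + (k ^+ 2)^-1) * w).
Proof.
move=> p2 /[dup] k01 /andP[k0 k1] r0 v0 t0 d0 w0 h.
set C := 4 + _.
have k2 : 0 < (k ^+ 2)^-1 by rewrite invr_gt0 exprn_gt0.
have C1 : 1 <= C by rewrite /C; lra.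
have p0 : 0 < p by lra.
have p1 : 1 <= p by lra.
have kt0 : 0 <= k * t by rewrite mulr_ge0 // ltW.
have Cw0 : 0 <= C * w by rewrite mulr_ge0 //; lra.
have sum : d `^ p + (k * t) `^ p + C * w `^ p <= (d + k * t + C * w) `^ p.
  apply: le_trans (powR_superadd _ _ _ _ p1 _ Cw0); last exact: addr_ge0.
  apply: lerD; first exact: powR_superadd.
  rewrite powRM //; last lra.
  by rewrite ler_wpM2r ?powR_ge0 // le1r_powR.
have tk := powR_young _ _ _ _ _ p2 k01 w0 t0.
have wp0 := powR_ge0 w p.
have vp0 := powR_ge0 v p.
have rp0 := powR_ge0 r p.
have D0 : 0 <= d + k * t + C * w by rewrite !addr_ge0.
have one : 0 < (1 : R) <= 1 by rewrite ltr01 lexx.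
have half : 0 < (2^-1 : R) <= 1 by lra.
split.
  apply: (powR_le_cancel _ _ _ _ p0) => //; apply: le_trans sum.
  have := powR_young _ _ _ _ _ p2 one w0 v0.
  rewrite mul1r expr1n invr1 mul1r /C; lra.
apply: (powR_le_cancel _ _ _ _ p0) => //; first by rewrite mulr_ge0.
rewrite powRM //.
have : 2 * (d + k * t + C * w) `^ p <= 2 `^ p * (d + k * t + C * w) `^ p.
  by rewrite ler_wpM2r ?powR_ge0 // le1r_powR // ler1n.
apply: le_trans; rewrite -ler_pdivrMl //; apply: le_trans sum.
have := powR_young _ _ _ _ _ p2 half w0 v0.
rewrite powRM // ?invr_ge0 //.
have : 2^-1 `^ p * v `^ p <= 2^-1 * v `^ p.
  by rewrite ler_wpM2r // ge1r_powR.
have -> : ((2^-1 : R) ^+ 2)^-1 = 4 by rewrite exprVn invrK expr2; lra.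
rewrite /C; lra.
Qed.

(** * Recursion for the residuals and convergence rates *)

(** The discrete stability estimate behind both stopping rules.  [t n] and
    [res n] stand for the linearized error and the residual of the [n]-th
    iterate, [d n] and [r n] for the linearized residuals of the exact solution
    and of the new iterate, and [w n] measures the smoothness of the solution
    on the scale of the [n]-th regularization parameter.  The point is that the
    factor of [delta] in the residual bound is below [tau]. *)
Lemma residual_recursion (R : realType) (p theta tau : R) :
  2 <= p -> 1 < theta -> 1 < tau ->
  exists eta C : R, [/\ 0 < eta <= 4^-1, 1 <= C &
  forall (delta : R) (m : nat) (w t v r d res : nat -> R),
    0 <= delta -> (forall n, 0 <= w n) -> (forall n, 0 <= t n) ->
    (forall n, 0 <= v n) -> (forall n, 0 <= r n) -> (forall n, 0 <= d n) ->
    t 0%N <= w 0%N -> res 0%N <= delta + 2 * t 0%N ->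
    (forall n, (n < m)%N ->
      [/\ w n <= theta * w n.+1,
          r n `^ p + v n.+1 `^ p
            <= d n `^ p + w n `^ (p - 1) * (v n.+1 + t n.+1),
          d n <= delta + 2 * eta * t n,
          t n.+1 <= r n + delta + 3 * eta * t n + eta * t n.+1 &
          res n.+1 <= r n + 3 * eta * t n + 2 * eta * t n.+1]) ->
    forall n, (n <= m)%N ->
      t n <= C * (delta + w n) /\
      res n <= (1 + tau) / 2 * delta + C * w n].
Proof.
move=> p2 th1 tau1.
(* [k] and [eta] make the coefficient of [delta] in the residual bound at most
   [1 + 5 * k + 35 * eta <= (1 + tau) / 2] *)
pose k : R := Num.min 4^-1 ((tau - 1) / 20).
have k0 : 0 < k by rewrite lt_min; apply/andP; split; lra.
have k4 : k <= 4^-1 by rewrite ge_min lexx.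
have kt : k <= (tau - 1) / 20 by rewrite ge_min lexx orbT.
pose C1 : R := 4 + (k ^+ 2)^-1.
have step1 := energy_step R p k.
rewrite -/C1 in step1.
have C14 : 4 <= C1 by rewrite lerDl invr_ge0 exprn_ge0 // ltW.
pose eta : R := Num.min 50^-1 (Num.min (20 * theta)^-1 ((tau - 1) / 140)).
have th0 : 0 < (20 * theta)^-1 by rewrite invr_gt0; lra.
have e0 : 0 < eta by rewrite !lt_min th0; apply/andP; split; lra.
have e50 : eta <= 50^-1 by rewrite ge_min lexx.
have eth : eta <= (20 * theta)^-1 by rewrite !ge_min lexx !orbT.
have etau : eta <= (tau - 1) / 140 by rewrite !ge_min lexx !orbT.
have {}eth : 20 * (eta * theta) <= 1.
  rewrite mulrCA -ler_pdivlMr; last lra.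
  by rewrite div1r.
clearbody C1 eta k.
pose M : R := 4 * C1 * theta.
have M16 : 16 <= M.
  have := ler_pM (ler0n _ 4) ler01 C14 (ltW th1).
  by rewrite /M -mulrA; lra.
have CM : C1 * theta <= M / 4 by rewrite /M; lra.
clearbody M.
have MM : M <= M * theta by rewrite ler_peMr; lra.
pose C : R := 3 * (M * theta) + 5.
have CE : C = 3 * (M * theta) + 5 by [].
clearbody C; exists eta, C; split; first by rewrite e0 /=; lra.
  by rewrite CE; lra.
move=> delta m w t v r d res de0 w0 t0 v0 r0 d0 tw0 res0 step.
have k01 : 0 < k <= 1 by rewrite k0; lra.
have tn n : (n <= m)%N -> t n <= 5 * delta + M * w n.
  elim: n => [_|n IH nm].
    apply: le_trans tw0 _.
    have : w 0%N <= M * w 0%N by rewrite ler_peMl //; lra.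
    by lra.
  have [wth en dn t1 _] := step n nm.
  have {}IH := IH (ltnW nm).
  have [rn _] := step1 _ _ _ _ _ p2 k01 (r0 n) (v0 n.+1) (t0 n.+1)
                   (d0 n) (w0 n) en.
  have a1 : k * t n.+1 <= 4^-1 * t n.+1 by rewrite ler_wpM2r.
  have a2 : eta * t n.+1 <= 4^-1 * t n.+1.
    by rewrite ler_wpM2r //; lra.
  have a3 : eta * t n <= eta * (5 * delta + M * w n) by rewrite ler_wpM2l // ltW.
  have a4 : eta * delta <= 50^-1 * delta by rewrite ler_wpM2r.
  have a5 : eta * (M * w n) <= 20^-1 * (M * w n.+1).
    have h1 : eta * (M * w n) <= eta * (M * (theta * w n.+1)).
      by rewrite ler_wpM2l ?(ltW e0) // ler_wpM2l //; lra.
    have h2 : 20 * (eta * theta) * (M * w n.+1) <= 1 * (M * w n.+1).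
      by rewrite ler_wpM2r // mulr_ge0 //; lra.
    by lra.
  have a6 : C1 * w n <= 4^-1 * (M * w n.+1).
    apply: (@le_trans _ _ (C1 * (theta * w n.+1))).
      by rewrite ler_wpM2l //; lra.
    by rewrite mulrA (mulrA 4^-1) ler_wpM2r //; lra.
  by lra.
move=> n nm.
have wM0 : 0 <= M * w n by rewrite mulr_ge0 //; lra.
have wMt : M * w n <= M * theta * w n by rewrite ler_wpM2r.
split.
  apply: le_trans (tn n nm) _; rewrite mulrDr CE.
  have : 0 <= M * theta * delta by rewrite !mulr_ge0 //; lra.
  have := w0 n; lra.
case: n nm wM0 wMt => [_|n nm] wM0 wMt.
  apply: le_trans res0 _.
  have : delta <= (1 + tau) / 2 * delta by rewrite ler_peMl //; lra.
  have : w 0%N <= M * w 0%N by rewrite ler_peMl //; lra.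
  have := w0 0%N; move: tw0 wM0 wMt; rewrite CE; lra.
have [wth en dn t1 res1] := step n nm.
have [rn _] := step1 _ _ _ _ _ p2 k01 (r0 n) (v0 n.+1) (t0 n.+1)
                   (d0 n) (w0 n) en.
have b1 := tn n (ltnW nm); have b2 := tn n.+1 nm.
have c1 : eta * t n <= eta * (5 * delta + M * w n) by rewrite ler_wpM2l // ltW.
have c2 : eta * t n.+1 <= eta * (5 * delta + M * w n.+1).
  by rewrite ler_wpM2l // ltW.
have c3 : k * t n.+1 <= k * (5 * delta + M * w n.+1) by rewrite ler_wpM2l // ltW.
have c4 : eta * delta <= (tau - 1) / 140 * delta by rewrite ler_wpM2r.
have c5 : k * delta <= (tau - 1) / 20 * delta by rewrite ler_wpM2r.
have c6 : eta * (M * w n.+1) <= 50^-1 * (M * w n.+1) by rewrite ler_wpM2r.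
have c7 : k * (M * w n.+1) <= 4^-1 * (M * w n.+1) by rewrite ler_wpM2r.
have c8 : M * w n <= M * theta * w n.+1.
  by rewrite -mulrA ler_wpM2l //; lra.
have c9 : eta * (M * w n) <= 50^-1 * (M * theta * w n.+1).
  apply: (@le_trans _ _ (50^-1 * (M * w n))).
    by rewrite ler_wpM2r // mulr_ge0 //; lra.
  by rewrite ler_wpM2l // invr_ge0.
have c10 : C1 * w n <= 4^-1 * (M * w n.+1).
  apply: (@le_trans _ _ (C1 * (theta * w n.+1))).
    by rewrite ler_wpM2l //; lra.
  by rewrite mulrA (mulrA 4^-1) ler_wpM2r //; lra.
rewrite CE; have := w0 n.+1; lra.
Qed.

Lemma powR_mean_le (R : realType) (nu v t : R) :
  0 < nu <= 1 -> 0 <= v -> 0 <= t -> v `^ (1 - nu) * t `^ nu <= v + t.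
Proof.
move=> /andP[nu0 nu1] v0 t0; have vt0 : 0 <= v + t by rewrite addr_ge0.
have nu1' : 0 <= 1 - nu by lra.
apply: (@le_trans _ _ ((v + t) `^ (1 - nu) * (v + t) `^ nu)).
  apply: ler_pM; rewrite ?powR_ge0 // powR_le ?(ltW nu0) //.
  - by rewrite lerDl.
  - by rewrite lerDr.
rewrite -powRD; first by rewrite subrK powRr1.
by rewrite subrK oner_eq0.
Qed.

Lemma le_mul_powR_self (R : realType) (p nu b D : R) :
  2 <= p -> 0 < nu <= 1 -> 0 <= b -> 0 <= D ->
  D <= b * D `^ ((1 - nu) / p) -> D <= b `^ (p / (p - 1 + nu)).
Proof.
move=> p2 /andP[nu0 nu1] b0; rewrite le_eqVlt => /orP[/eqP <- _|D0 h].
  exact: powR_ge0.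
have p0 : 0 < p by lra.
have q0 : 0 < p - 1 + nu by lra.
have pn0 : p != 0 by rewrite gt_eqF.
have qn0 : p - 1 + nu != 0 by rewrite gt_eqF.
have hb : D `^ ((p - 1 + nu) / p) <= b.
  have DD : 0 < D `^ ((1 - nu) / p) by exact: powR_gt0.
  rewrite -(ler_pM2r DD) -powRD; last by rewrite (gt_eqF D0) implybT.
  have -> : (p - 1 + nu) / p + (1 - nu) / p = 1 by field.
  by rewrite powRr1 // ltW.
have -> : D = (D `^ ((p - 1 + nu) / p)) `^ (p / (p - 1 + nu)).
  rewrite -powRrM.
  have -> : (p - 1 + nu) / p * (p / (p - 1 + nu)) = 1.
    by field; rewrite pn0 qn0.
  by rewrite powRr1 // ltW.
by apply: powR_le; rewrite ?powR_ge0 // divr_ge0 // ltW.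
Qed.

(** The balance of the two terms of the energy inequality once the regularization
    parameter is bounded below in terms of the noise level. *)
Lemma rate_of_energy (R : realType) (p nu c alpha beta delta D d t : R) :
  2 <= p -> 0 < nu <= 1 -> 0 < c -> 0 < alpha -> 0 <= beta -> 0 < delta ->
  0 <= D -> 0 <= d <= c * delta -> 0 <= t <= c * delta ->
  alpha * D <= d `^ p + alpha * (beta * D `^ ((1 - nu) / p) * t `^ nu) ->
  delta <= c * (alpha `^ ((p - 1 + nu) / p) * beta) `^ (p - 1)^-1 ->
  D <= (2 * c `^ p * c `^ (p * (p - 1) / (p - 1 + nu))
         + (2 * c `^ nu) `^ (p / (p - 1 + nu)))
       * beta `^ (p / (p - 1 + nu)) * delta `^ (p * nu / (p - 1 + nu)).
Proof.
move=> p2 nu01 c0 a0 b0 de0 D0 /andP[d0 dc] /andP[t0 tc] en low.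
have /andP[nu0 nu1] := nu01.
have p0 : 0 < p by lra.
have q0 : 0 < p - 1 + nu by lra.
have p10 : 0 < p - 1 by lra.
have pn0 : p != 0 by rewrite gt_eqF.
have qn0 : p - 1 + nu != 0 by rewrite gt_eqF.
have p1n0 : p - 1 != 0 by rewrite gt_eqF.
set q := p / (p - 1 + nu).
have q_ge0 : 0 <= q by rewrite divr_ge0 // ltW.
set T := beta `^ q * delta `^ (p * nu / (p - 1 + nu)).
have T0 : 0 <= T by rewrite mulr_ge0 ?powR_ge0.
rewrite -mulrA -/T mulrDl.
have dT : delta `^ p <= c `^ (p * (p - 1) / (p - 1 + nu)) * alpha * T.
  have h1 : delta `^ (p - 1) <= c `^ (p - 1) * (alpha `^ ((p - 1 + nu) / p) * beta).
    have := powR_le _ _ _ _ (ltW p10) (ltW de0) low.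
    rewrite powRM ?powR_ge0 ?(ltW c0) // powRVK //.
    by rewrite mulr_ge0 ?powR_ge0.
  have h2 := powR_le _ _ _ _ q_ge0 (powR_ge0 _ _) h1.
  rewrite !powRM ?powR_ge0 ?mulr_ge0 ?powR_ge0 // -!powRrM in h2.
  have e1 : (p - 1 + nu) / p * q = 1 by rewrite /q; field; rewrite pn0 qn0.
  have e2 : (p - 1) * q = p * (p - 1) / (p - 1 + nu) by rewrite /q; field.
  rewrite e1 e2 powRr1 ?(ltW a0) // in h2.
  have -> : p = p * (p - 1) / (p - 1 + nu) + p * nu / (p - 1 + nu) by field.
  rewrite powRD; last by rewrite (gt_eqF de0) implybT.
  have -> : p * (p - 1) / (p - 1 + nu) + p * nu / (p - 1 + nu) = p by field.
  rewrite /T [leRHS]mulrA ler_wpM2r ?powR_ge0 //.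
  by rewrite [leRHS]mulrA in h2.
have [h|h] := leP (alpha * (beta * D `^ ((1 - nu) / p) * t `^ nu)) (d `^ p).
  have aD : alpha * D <= 2 * d `^ p by lra.
  have dp : d `^ p <= c `^ p * delta `^ p.
    by rewrite -powRM ?(ltW c0) ?(ltW de0) // powR_le // ltW.
  rewrite -[D]addr0 lerD //; last by rewrite mulr_ge0 ?powR_ge0.
  rewrite -(ler_pM2l a0); apply: le_trans aD _.
  have cp : c `^ p * delta `^ p <=
      c `^ p * (c `^ (p * (p - 1) / (p - 1 + nu)) * alpha * T).
    by rewrite ler_wpM2l ?powR_ge0.
  apply: (@le_trans _ _
    (2 * (c `^ p * (c `^ (p * (p - 1) / (p - 1 + nu)) * alpha * T)))).
    by lra.
  rewrite le_eqVlt; apply/orP; left; apply/eqP.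
  by ring.
have {h}hD : D <= 2 * beta * t `^ nu * D `^ ((1 - nu) / p).
  rewrite -(ler_pM2l a0).
  have -> : alpha * (2 * beta * t `^ nu * D `^ ((1 - nu) / p)) =
    2 * (alpha * (beta * D `^ ((1 - nu) / p) * t `^ nu)) by ring.
  lra.
have b20 : 0 <= 2 * beta * t `^ nu by rewrite !mulr_ge0 ?powR_ge0.
have := le_mul_powR_self _ _ _ _ _ p2 nu01 b20 D0 hD; rewrite -/q.
move=> /le_trans; apply.
have TE : (2 * c `^ nu) `^ q * T = (2 * c `^ nu * beta * delta `^ nu) `^ q.
  rewrite (powRM _ (mulr_ge0 (mulr_ge0 _ (powR_ge0 _ _)) b0)) ?powR_ge0 //.
  rewrite (powRM _ (mulr_ge0 _ (powR_ge0 _ _)) b0) // -(powRrM delta).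
  have -> : nu * q = p * nu / (p - 1 + nu) by rewrite /q; field.
  by rewrite /T mulrA.
rewrite TE; apply: (@le_trans _ _ ((2 * c `^ nu * beta * delta `^ nu) `^ q)).
  apply: powR_le => //.
  have tn : t `^ nu <= c `^ nu * delta `^ nu.
    by rewrite -powRM ?(ltW c0) ?(ltW de0) // powR_le // ltW.
  have := ler_wpM2l (mulr_ge0 (ler0n _ 2) b0) tn; lra.
by rewrite lerDr !mulr_ge0 ?powR_ge0.
Qed.

(** Without the source condition the cross term is controlled by the distance [E]
    of the initial dual element; this is the source condition with exponent 0
    and constant [gamma * E]. *)
Lemma apriori_cross_term (R : realType) (p gamma E alpha D e : R) :
  2 <= p -> 0 < gamma -> 0 <= E -> 0 < alpha -> 0 <= D -> 0 <= e ->
  e `^ p <= gamma `^ p * D ->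
  alpha * (E * e) <=
    ((gamma * E) `^ (p - 1)^-1 * alpha `^ p^-1) `^ (p - 1)
      * (alpha * D) `^ p^-1.
Proof.
move=> p2 g0 E0 a0 D0 e0 eD.
have p0 : 0 < p by lra.
have pn0 : p != 0 by rewrite gt_eqF.
have p1n0 : p - 1 != 0 by rewrite gt_eqF //; lra.
have eg : e <= gamma * D `^ p^-1.
  apply: (powR_le_cancel _ p) => //; first by rewrite mulr_ge0 ?powR_ge0 // ltW.
  by rewrite powRM ?powR_ge0 ?(ltW g0) // powRVK.
rewrite powRM ?powR_ge0 // powRVK ?mulr_ge0 ?(ltW g0) //.
rewrite (powRM _ (ltW a0) D0).
have aE : alpha `^ p^-1 * (alpha `^ p^-1) `^ (p - 1) = alpha.
  by rewrite mulr_powRB1 ?powR_ge0 // powRVK // ltW.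
have -> : gamma * E * (alpha `^ p^-1) `^ (p - 1) *
    (alpha `^ p^-1 * D `^ p^-1) =
    (alpha `^ p^-1 * (alpha `^ p^-1) `^ (p - 1)) * (E * (gamma * D `^ p^-1)).
  by ring.
by rewrite aE ler_wpM2l ?(ltW a0) // ler_wpM2l.
Qed.

(** The cross term allowed by the source condition, written with
    [w = (alpha `^ ((p - 1 + nu) / p) * beta) `^ (p - 1)^-1] and
    [v = (alpha * D) `^ p^-1]. *)
Lemma source_cross_term (R : realType) (p nu alpha beta D t : R) :
  2 <= p -> 0 < nu <= 1 -> 0 < alpha -> 0 <= beta -> 0 <= D -> 0 <= t ->
  alpha * (beta * D `^ ((1 - nu) / p) * t `^ nu) =
  ((alpha `^ ((p - 1 + nu) / p) * beta) `^ (p - 1)^-1) `^ (p - 1)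
    * (((alpha * D) `^ p^-1) `^ (1 - nu) * t `^ nu).
Proof.
move=> p2 /andP[nu0 nu1] a0 b0 D0 t0.
have pn0 : p != 0 by rewrite gt_eqF //; lra.
have p1n0 : p - 1 != 0 by rewrite gt_eqF //; lra.
rewrite powRVK ?mulr_ge0 ?powR_ge0 //.
rewrite -powRrM (mulrC p^-1) (powRM _ (ltW a0) D0).
have aE : alpha `^ ((p - 1 + nu) / p) * alpha `^ ((1 - nu) / p) = alpha.
  rewrite -powRD; last by rewrite (gt_eqF a0) implybT.
  have -> : (p - 1 + nu) / p + (1 - nu) / p = 1 by field.
  by rewrite powRr1 // ltW.
rewrite -{1}aE; ring.
Qed.

(** What both stopping rules have in common: unless [N = 0], the last two
    residuals are at most [2 * tol], one of the two residuals at [N.-1] and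
    before it exceeds [tol], and no earlier pair of consecutive residuals is
    bounded by [tol]. *)
Lemma stops_facts (R : realType) (res : nat -> R) (tol : R) (N : nat) :
  (forall n, 0 <= res n) -> stops_mean res tol N \/ stops_max res tol N ->
  (N = 0%N /\ res 0%N <= tol) \/
  [/\ (0 < N)%N, tol < res 0%N,
      res N <= 2 * tol /\ res N.-1 <= 2 * tol,
      (exists j, [/\ tol < res j, (j <= N.-1)%N & (N.-1 <= j.+1)%N]) &
      forall n, (0 < n < N)%N -> res n <= tol -> res n.-1 <= tol -> False].
Proof.
move=> res0; rewrite /stops_mean /stops_max.
have [r0|r0] := leP (res 0%N) tol; first by case=> ->; left.
have t_half a b : 0 <= b -> 2^-1 * (a + b) <= tol -> a <= 2 * tol by lra.
case=> -[N1 sN nsN]; right.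
  have rN : res N <= 2 * tol /\ res N.-1 <= 2 * tol.
    rewrite /mean_small in sN; split; first exact: t_half (res0 N.-1) sN.
    by rewrite addrC in sN; exact: t_half (res0 N) sN.
  split => //.
    case: N N1 nsN {sN rN} => [//|[|k]] _ nsN; first by exists 0%N.
    have := nsN k.+1; rewrite /= ltnSn /mean_small /= => /(_ isT).
    have [h1 _|h1] := ltP tol (res k.+1); first by exists k.+1.
    have [h2 _|h2] := ltP tol (res k); first by exists k.
    by move=> h; exfalso; apply: h; lra.
  move=> n nN h1 h2; apply: (nsN n nN); rewrite /mean_small; lra.
have [sN1 sN2] : res N <= tol /\ res N.-1 <= tol.
  by move: sN; rewrite /max_small ge_max => /andP[].
have tol0 : 0 <= tol by apply: le_trans sN1.
split => //.
- exact: ltn_trans N1.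
- by split; lra.
- case: N N1 nsN {sN sN1 sN2} => [//|[//|k]] _ nsN.
  have := nsN k.+1; rewrite /= ltnSn /max_small /= => /(_ isT).
  have [h1 _|h1] := ltP tol (res k.+1); first by exists k.+1.
  have [h2 _|h2] := ltP tol (res k); first by exists k.
  by move=> h; exfalso; apply: h; rewrite ge_max h1.
- by move=> n nN h1 h2; apply: (nsN n nN); rewrite /max_small ge_max h1.
Qed.

(** The convergence analysis in terms of real sequences.  [e n], [t n] and [D n]
    stand for the error, the linearized error and the Bregman distance of the
    [n]-th iterate, [g n] for the pairing of [xi0 - xidag] with the error, and
    [res], [r], [d] are as in [residual_recursion].  [good n] says that the
    [n]-th iterate is so close to the solution that the estimates derived from
    the nonlinearity condition hold. *)
Lemma abstract_rates (R : realType) (p gamma theta tau nu : R) :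
  2 <= p -> 0 < gamma -> 1 < theta -> 1 < tau -> 0 < nu <= 1 ->
  exists eta A C : R, [/\ 0 < eta <= 4^-1, 0 < A, 0 < C &
  forall (N : nat) (beta delta E : R) (alpha e t D g res r d : nat -> R)
    (good : nat -> Prop),
  0 <= beta -> 0 < delta -> 0 <= E -> (forall n, 0 < alpha n) ->
  (forall n, 1 <= alpha n / alpha n.+1 <= theta) ->
  (forall n, [/\ 0 <= e n, 0 <= t n, 0 <= res n, 0 <= r n & 0 <= d n]) ->
  (forall n, (n <= N)%N -> [/\ 0 <= D n, e n `^ p <= gamma `^ p * D n,
     g n <= E * e n & g n <= beta * D n `^ ((1 - nu) / p) * t n `^ nu]) ->
  D 0%N <= g 0%N -> t 0%N <= alpha 0%N `^ p^-1 / gamma * e 0%N ->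
  (forall n, (n < N)%N ->
     r n `^ p + alpha n * D n.+1 <= d n `^ p + alpha n * g n.+1) ->
  (forall n, (n <= N)%N -> e n <= A * E `^ (p - 1)^-1 -> good n) ->
  (forall n, (n <= N)%N -> good n ->
     res n <= delta + 2 * t n /\ t n <= res n + delta + eta * t n) ->
  (forall n, (n < N)%N -> good n -> d n <= delta + 2 * eta * t n) ->
  (forall n, (n < N)%N -> good n -> good n.+1 ->
     t n.+1 <= r n + delta + 3 * eta * t n + eta * t n.+1 /\
     res n.+1 <= r n + 3 * eta * t n + 2 * eta * t n.+1) ->
  stops_mean res (tau * delta) N \/ stops_max res (tau * delta) N ->
  D N <= C * beta `^ (p / (p - 1 + nu)) * delta `^ (p * nu / (p - 1 + nu))].
Proof.
move=> p2 g0 th1 tau1 nu01; have /andP[nu0 nu1] := nu01.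
have p0 : 0 < p by lra.
have pn0 : p != 0 by rewrite gt_eqF.
have p10 : 0 < p - 1 by lra.
have p1n0 : p - 1 != 0 by rewrite gt_eqF.
have ip : 0 < p^-1 <= 1 by rewrite invr_gt0 p0 invf_le1 //; lra.
have ip1 : 0 < (p - 1)^-1 <= 1 by rewrite invr_gt0 p10 invf_le1 //; lra.
have th0 : 0 < theta by lra.
have tau0 : 0 <= tau by lra.
have tau10 : 0 < tau - 1 by lra.
have q_gt0 : 0 < p - 1 + nu by lra.
have qn0 : p - 1 + nu != 0 by rewrite gt_eqF.
have q01 : 0 < (p - 1 + nu) / p <= 1.
  by rewrite divr_gt0 //= ler_pdivrMr // mul1r; lra.
have [eta [Cr [/[dup] eta01 /andP[eta0 eta4] Cr1 rec]]] :=
  residual_recursion R p theta tau p2 th1 tau1.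
have eta1 : eta <= 1 by lra.
have Cr0 : 0 <= Cr by lra.
(* [delta > c0 * w n] forces the residual at [n] below [tau * delta] *)
pose c0 : R := 2 * Cr / (tau - 1).
have c00 : 0 < c0 by rewrite divr_gt0 //; lra.
pose c1 : R := theta * c0.
have c10 : 0 < c1 by rewrite mulr_gt0.
have c01 : c0 <= c1 by rewrite ler_peMl ?(ltW c00) // ltW.
have c0E : c0 * (tau - 1) = 2 * Cr.
  by rewrite /c0 divfK // subr_eq0 gt_eqF.
have c1E : c1 = theta * c0 by [].
clearbody c0 c1.
pose A1 : R := 2 * (c1 + 2 * Cr * (c1 + 1) + 5).
have A10 : 0 < A1.
  have : 0 < Cr * (c1 + 1) by rewrite mulr_gt0 //; lra.
  by rewrite /A1; lra.
pose gq : R := gamma `^ (p - 1)^-1.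
have gq0 : 0 < gq by exact: powR_gt0.
pose A : R := gamma * gq * (A1 + 1).
have A0 : 0 < A by rewrite !mulr_gt0 //; lra.
pose c : R := 4 * (tau + 1) + theta * c0.
pose C : R := 2 * c `^ p * c `^ (p * (p - 1) / (p - 1 + nu))
         + (2 * c `^ nu) `^ (p / (p - 1 + nu)).
have cE : c = 4 * (tau + 1) + c1 by rewrite c1E.
have c_gt0 : 0 < c by rewrite cE; lra.
have cge : 4 * (tau + 1) <= c by rewrite cE; lra.
have c1c : c1 <= c by rewrite cE; lra.
clearbody c.
have C0 : 0 < C.
  by rewrite ltr_pwDl ?powR_ge0 // !mulr_gt0 ?powR_gt0.
exists eta, A, C; split => //.
move=> N beta delta E alpha e t D g res r d good b0 de0 E0 a0 ath pos.
move=> facts D00 t00 energy goodP resP dP stepP /stops_facts stop.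
have {}stop := stop (fun n => let: And5 _ _ h _ _ := pos n in h).
have e0 n : 0 <= e n by case: (pos n).
have t0 n : 0 <= t n by case: (pos n).
have res0 n : 0 <= res n by case: (pos n).
have r0 n : 0 <= r n by case: (pos n).
have d0 n : 0 <= d n by case: (pos n).
have ale n : alpha n.+1 <= alpha n.
  by have /andP[+ _] := ath n; rewrite ler_pdivlMr // mul1r.
have aleth n : alpha n <= theta * alpha n.+1.
  by have /andP[_ +] := ath n; rewrite ler_pdivrMr.
have powth x (b : R) : 0 < b <= 1 -> 0 <= x -> (theta * x) `^ b <= theta * x `^ b.
  move=> b01 x0; rewrite powRM // ?(ltW th0) // ler_wpM2r ?powR_ge0 //.
  by rewrite powR_le_expand // ltW.
pose s : R := E `^ (p - 1)^-1.
pose G : R := (gamma * E) `^ (p - 1)^-1.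
have GE : G = gq * s by rewrite /G powRM // ltW.
have G0 : 0 <= G by exact: powR_ge0.
pose wE n : R := G * alpha n `^ p^-1.
have wE0 n : 0 <= wE n by rewrite mulr_ge0 ?powR_ge0.
have wEth n : wE n <= theta * wE n.+1.
  rewrite /wE mulrCA ler_wpM2l //; apply: le_trans (powth _ _ ip (ltW (a0 _))).
  by apply: powR_le => //; [case/andP: ip => /ltW|exact: ltW].
have wEle n : wE n.+1 <= wE n.
  rewrite ler_wpM2l // powR_le //; [by case/andP: ip => /ltW|exact: ltW].
pose wS n : R := (alpha n `^ ((p - 1 + nu) / p) * beta) `^ (p - 1)^-1.
have wS0 n : 0 <= wS n by exact: powR_ge0.
have wSth n : wS n <= theta * wS n.+1.
  apply: (@le_trans _ _
    ((theta * (alpha n.+1 `^ ((p - 1 + nu) / p) * beta)) `^ (p - 1)^-1)).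
    apply: powR_le; [by case/andP: ip1 => /ltW|by rewrite mulr_ge0 ?powR_ge0|].
    rewrite mulrA ler_wpM2r //.
    apply: le_trans (powth _ _ q01 (ltW (a0 _))).
    by apply: powR_le => //; [case/andP: q01 => /ltW|exact: ltW].
  by apply: powth => //; rewrite mulr_ge0 ?powR_ge0.
pose v n : R := (alpha n.-1 * D n) `^ p^-1.
have v0 n : 0 <= v n by exact: powR_ge0.
have v0E : v 0%N = (alpha 0%N * D 0%N) `^ p^-1 by [].
have vSE n : v n.+1 = (alpha n * D n.+1) `^ p^-1 by [].
have vE n : (n <= N)%N -> v n `^ p = alpha n.-1 * D n.
  by move=> nN; rewrite powRVK // mulr_ge0 ?(ltW (a0 _)) //; case: (facts n nN).
clearbody v.
have eDg n : (n <= N)%N -> e n <= gamma * D n `^ p^-1.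
  move=> nN; have [Dn eD _ _] := facts n nN.
  apply: (powR_le_cancel _ p) => //; first by rewrite mulr_ge0 ?powR_ge0 // ltW.
  by rewrite powRM ?powR_ge0 ?(ltW g0) // powRVK.
have eG0 : e 0%N <= gamma * G.
  have [Dn eD gE _] := facts 0%N (leq0n _).
  have [->|en0] := eqVneq (e 0%N) 0; first by rewrite mulr_ge0 // ltW.
  have e00 : 0 < e 0%N by rewrite lt_def en0 e0.
  apply: (powR_le_cancel _ (p - 1)) => //; first by rewrite mulr_ge0 // ltW.
  rewrite powRM ?(ltW g0) // powRVK ?mulr_ge0 ?(ltW g0) //.
  rewrite -(ler_pM2l e00) mulr_powRB1 //; apply: le_trans eD _.
  rewrite -(mulr_powRB1 (ltW g0) p0).
  have := ler_wpM2l (mulr_ge0 (ltW g0) (powR_ge0 gamma (p - 1)))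
            (le_trans D00 gE); clear; lra.
have tE0 : t 0%N <= wE 0%N.
  apply: le_trans t00 _.
  rewrite /wE (mulrC G) -mulrA ler_wpM2l ?powR_ge0 //.
  by rewrite ler_pdivrMl.
have t0v : t 0%N <= v 0%N.
  apply: le_trans t00 _.
  have [Dn _ _ _] := facts 0%N (leq0n _).
  rewrite v0E (powRM _ (ltW (a0 _)) Dn) -mulrA ler_wpM2l ?powR_ge0 //.
  by rewrite ler_pdivrMl // eDg.
have energyE n : (n < N)%N ->
    r n `^ p + v n.+1 `^ p <= d n `^ p + wE n `^ (p - 1) * v n.+1.
  move=> nN; rewrite vE //=; apply: le_trans (energy n nN) _.
  have [Dn eD gE _] := facts n.+1 nN.
  rewrite lerD2l vSE; apply: le_trans _
    (apriori_cross_term _ _ _ _ _ _ _ p2 g0 E0 (a0 n) Dn (e0 n.+1) eD).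
  by rewrite ler_wpM2l // ltW.
have source n m : (n <= N)%N -> alpha m * g n <=
    wS m `^ (p - 1) * (((alpha m * D n) `^ p^-1) `^ (1 - nu) * t n `^ nu).
  move=> nN; have [Dn _ _ gS] := facts n nN.
  rewrite /wS -(source_cross_term _ _ _ _ _ _ _ p2 nu01 (a0 m) b0 Dn (t0 n)).
  by rewrite ler_wpM2l // ltW.
have energyS n : (n < N)%N ->
    r n `^ p + v n.+1 `^ p <= d n `^ p + wS n `^ (p - 1) * (v n.+1 + t n.+1).
  move=> nN; rewrite {1}vE //=; apply: le_trans (energy n nN) _.
  rewrite lerD2l; apply: le_trans (source n.+1 n nN) _.
  by rewrite -vSE ler_wpM2l ?powR_ge0 // powR_mean_le.
have tS0 : t 0%N <= wS 0%N.
  apply: (le_trans t0v).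
  have [->|vn0] := eqVneq (v 0%N) 0; first exact: wS0.
  have v00 : 0 < v 0%N by rewrite lt_def vn0 v0.
  apply: (powR_le_cancel _ (p - 1)) => //.
  rewrite -(ler_pM2l v00) (mulr_powRB1 (v0 0%N) p0) (vE 0%N (leq0n _)) [leRHS]mulrC.
  apply: (@le_trans _ _ (alpha 0%N * g 0%N)); first by rewrite ler_wpM2l // ltW.
  apply: le_trans (source 0%N 0%N (leq0n _)) _.
  rewrite -v0E ler_wpM2l ?powR_ge0 //.
  apply: (@le_trans _ _ (v 0%N `^ (1 - nu) * v 0%N `^ nu)).
    rewrite ler_wpM2l ?powR_ge0 //.
    exact: (powR_le _ _ _ _ (ltW nu0) (t0 0%N) t0v).
  by rewrite -powRD ?subrK ?powRr1 ?oner_eq0.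
have sE : s = E `^ (p - 1)^-1 by [].
have s0 : 0 <= s by exact: powR_ge0.
have wEE n : wE n = G * alpha n `^ p^-1 by [].
have wSE n : wS n = (alpha n `^ ((p - 1 + nu) / p) * beta) `^ (p - 1)^-1 by [].
have A1E : A1 = 2 * (c1 + 2 * Cr * (c1 + 1) + 5) by [].
have AE : A = gamma * gq * (A1 + 1) by [].
rewrite -sE in goodP.
clearbody wE wS s G A A1 gq.
(* as long as [delta] is dominated by [wE], the iterates stay near the solution *)
have claim1 m : (m <= N)%N ->
    (forall k, (k < m)%N -> delta <= c1 * wE k) ->
    forall n, (n <= m)%N -> [/\ e n <= A * s, t n <= Cr * (delta + wE n) &
       res n <= (1 + tau) / 2 * delta + Cr * wE n].
  move=> mN small.
  have loc n : (n <= m)%N -> (forall k, (k <= n)%N -> e k <= A * s) ->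
      t n <= Cr * (delta + wE n) /\ res n <= (1 + tau) / 2 * delta + Cr * wE n.
    move=> nm en.
    have good_le k : (k <= n)%N -> good k.
      by move=> kn; apply: goodP (en k kn); apply: leq_trans kn (leq_trans nm mN).
    apply: (rec delta n wE t v r d res) => //; first exact: ltW.
      by case: (resP 0%N (leq0n _) (good_le 0%N (leq0n _))).
    move=> k kn; have kN : (k < N)%N by apply: leq_trans kn (leq_trans nm mN).
    have gk := good_le k (ltnW kn); have gk1 := good_le k.+1 kn.
    have [st1 st2] := stepP k kN gk gk1.
    split => //; last exact: dP.
    apply: le_trans (energyE k kN) _; rewrite lerD2l ler_wpM2l ?powR_ge0 //.
    by rewrite lerDl.
  have eA n : (n <= m)%N -> e n <= A * s.
    elim/ltn_ind: n => -[_ _|n IH nm].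
      apply: le_trans eG0 _; rewrite GE mulrA AE ler_wpM2r //.
      by rewrite ler_peMr ?lerDr ?(ltW A10) // mulr_ge0 // ltW.
    have IH' k : (k <= n)%N -> e k <= A * s.
      by move=> kn; apply: IH => //; exact: leq_trans kn (ltnW nm).
    have [tn _] := loc n (ltnW nm) IH'.
    have nN : (n < N)%N by exact: leq_trans nm mN.
    have dn := dP n nN (goodP n (ltnW nN) (IH' n (leqnn _))).
    have sm := small n nm.
    have k1 : 0 < (1 : R) <= 1 by rewrite ltr01 lexx.
    have en : r n `^ p + v n.+1 `^ p <=
        d n `^ p + wE n `^ (p - 1) * (v n.+1 + 0).
      by rewrite addr0; exact: energyE.
    have [_] := energy_step _ _ _ _ _ _ _ _ p2 k1 (r0 n) (v0 n.+1) (lexx 0)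
                  (d0 n) (wE0 n) en.
    rewrite mulr0 addr0 expr1n invr1 => vn.
    have tn' : t n <= Cr * (c1 + 1) * wE n.
      apply: le_trans tn _; rewrite -mulrA ler_wpM2l //.
      by rewrite mulrDl mul1r lerD2r.
    have et : eta * t n <= Cr * (c1 + 1) * wE n.
      by apply: le_trans tn'; rewrite ler_piMl.
    have vA : v n.+1 <= A1 * wE n.
      rewrite A1E; apply: le_trans vn _.
      have dn2 : d n <= c1 * wE n + 2 * (Cr * (c1 + 1) * wE n).
        by apply: le_trans dn _; rewrite -mulrA lerD // ler_wpM2l.
      have -> : 2 * (c1 + 2 * Cr * (c1 + 1) + 5) * wE n =
        2 * (c1 * wE n + 2 * (Cr * (c1 + 1) * wE n) + 5 * wE n) by ring.
      rewrite ler_wpM2l // lerD // ler_wpM2r //; clear; lra.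
    have [Dn _ _ _] := facts n.+1 nN.
    rewrite vSE in vA.
    have an : 0 < alpha n `^ p^-1 by exact: powR_gt0.
    have DA : D n.+1 `^ p^-1 <= A1 * G.
      rewrite -(ler_pM2l an).
      rewrite -(powRM _ (ltW (a0 n)) Dn).
      apply: le_trans vA _; rewrite wEE.
      by have -> : A1 * (G * alpha n `^ p^-1) = alpha n `^ p^-1 * (A1 * G) by ring.
    apply: le_trans (eDg n.+1 nN) _.
    apply: (@le_trans _ _ (gamma * (A1 * G))); first by rewrite ler_wpM2l // ltW.
    rewrite GE AE.
    have -> : gamma * (A1 * (gq * s)) = gamma * gq * A1 * s by ring.
    rewrite ler_wpM2r // ler_wpM2l ?lerDl //.
    by rewrite mulr_ge0 // ltW.
  move=> n nm; have [] := loc n nm (fun k kn => eA k (leq_trans kn nm)).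
  by split => //; exact: eA.
(* this is where the factor [(1 + tau) / 2] of [delta] is used *)
have small_res n : ~~ (delta <= c0 * wE n) ->
    res n <= (1 + tau) / 2 * delta + Cr * wE n -> res n <= tau * delta.
  rewrite -ltNge => lt1 le1; apply: le_trans le1 _.
  have h : c0 * wE n * (tau - 1) <= delta * (tau - 1).
    by rewrite ler_wpM2r ?(ltW lt1) ?(ltW tau10).
  have e1 : c0 * wE n * (tau - 1) = 2 * (Cr * wE n).
    by rewrite mulrAC c0E -mulrA.
  by rewrite e1 in h; move: h; clear; lra.
(* before the stopping index [delta] is dominated by [wE] *)
have claim2 n : (n < N)%N -> delta <= c1 * wE n.
  elim/ltn_ind: n => -[_ N0|k IH kN].
    apply: (@le_trans _ _ (c0 * wE 0%N)); last by rewrite ler_wpM2r.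
    apply: contraT => nle.
    have [//|_ _ r00] := claim1 0%N (leq0n _) _ 0%N (leqnn _).
    have := small_res 0%N nle r00.
    case: stop => [[N00 _]|[_ + _ _ _]]; first by rewrite N00 in N0.
    by rewrite ltNge => /negP.
  have [le0|nle] := boolP (delta <= c0 * wE k).
    apply: le_trans le0 _; rewrite c1E (mulrC theta) -mulrA.
    by rewrite ler_wpM2l // ltW.
  have nle1 : ~~ (delta <= c0 * wE k.+1).
    apply: contra nle => h; apply: (le_trans h).
    exact: ler_wpM2l (ltW c00) _ _ (wEle k).
  have sm j : (j < k.+1)%N -> delta <= c1 * wE j.
    by move=> jk; apply: IH => //; exact: ltn_trans jk kN.
  have [_ _ rk] := claim1 k.+1 (ltnW kN) sm k (leqnSn _).
  have [_ _ rk1] := claim1 k.+1 (ltnW kN) sm k.+1 (leqnn _).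
  case: stop => [[N0 _]|[_ _ _ _ ns]]; first by rewrite N0 in kN.
  exfalso; apply: (ns k.+1); first by rewrite kN.
  - exact: small_res.
  - exact: small_res.
have good_all n : (n <= N)%N -> good n.
  by move=> nN; apply: goodP => //; case: (claim1 N (leqnn _) claim2 n nN).
have resS n : (n <= N)%N -> res n <= (1 + tau) / 2 * delta + Cr * wS n.
  move=> nN; suff [] : t n <= Cr * (delta + wS n) /\
     res n <= (1 + tau) / 2 * delta + Cr * wS n by [].
  apply: (rec delta N wS t v r d res) => //; first exact: ltW.
    by case: (resP 0%N (leq0n _) (good_all 0%N (leq0n _))).
  move=> k kN; have [st1 st2] := stepP k kN (good_all k (ltnW kN)) (good_all _ kN).
  by split => //; [exact: energyS|apply: dP => //; apply: good_all; exact: ltnW].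
have t_le n : (n <= N)%N -> res n <= 2 * (tau * delta) ->
    t n <= 4 * (tau + 1) * delta.
  move=> nN rn; have [_ tn] := resP n nN (good_all n nN).
  have : eta * t n <= 4^-1 * t n by rewrite ler_wpM2r.
  have : 0 <= tau * delta by rewrite mulr_ge0 ?(ltW de0).
  by move: rn tn (ltW de0); clear; lra.
have td0 : 0 <= tau * delta by rewrite mulr_ge0 ?(ltW de0).
have tc n : (n <= N)%N -> res n <= 2 * (tau * delta) -> 0 <= t n <= c * delta.
  move=> nN rn; rewrite t0; apply: le_trans (t_le n nN rn) _.
  by rewrite ler_wpM2r // ltW.
case: stop => [[N0 rN]|[N1 _ [rN rN1] [j [rj jN jN1]] _]].
  have t0c : 0 <= t 0%N <= c * delta by apply: tc => //; move: rN td0; clear; lra.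
  have [Dn _ _ gS] := facts 0%N (leq0n _).
  have b20 : 0 <= beta * t 0%N `^ nu by rewrite mulr_ge0 ?powR_ge0.
  have DD : D 0%N <= beta * t 0%N `^ nu * D 0%N `^ ((1 - nu) / p).
    by rewrite mulrAC; exact: le_trans D00 gS.
  rewrite N0; apply: le_trans (le_mul_powR_self _ _ _ _ _ p2 nu01 b20 Dn DD) _.
  set q := p / (p - 1 + nu).
  have q_ge0 : 0 <= q by rewrite divr_ge0 // ltW.
  rewrite powRM ?powR_ge0 // [leRHS]mulrAC [leRHS]mulrC ler_wpM2l ?powR_ge0 //.
  have /andP[_ t0c'] := t0c.
  apply: (@le_trans _ _ ((2 * c `^ nu * delta `^ nu) `^ q)).
    apply: powR_le; rewrite ?powR_ge0 //.
    have : t 0%N `^ nu <= c `^ nu * delta `^ nu.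
      by rewrite -powRM ?(ltW c_gt0) ?(ltW de0) // powR_le // ltW.
    have : 0 <= c `^ nu * delta `^ nu by rewrite mulr_ge0 ?powR_ge0.
    clear; lra.
  rewrite powRM ?mulr_ge0 ?powR_ge0 // -(powRrM delta).
  have -> : nu * q = p * nu / (p - 1 + nu).
    by rewrite /q; field.
  by rewrite ler_wpM2r ?powR_ge0 // /C lerDr !mulr_ge0 ?powR_ge0.
case: N N1 {claim1 claim2 source} facts energy goodP resP dP stepP vE eDg energyE
  energyS good_all resS t_le tc rN rN1 jN jN1 => // k _ facts energy _ resP dP _ _ _
  _ _ good_all resS _ tc rN rN1 jN jN1.
have tk := tc k (leqnSn _) rN1; have tk1 := tc k.+1 (leqnn _) rN.
have [Dn _ _ gS] := facts k.+1 (leqnn _).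
apply: (rate_of_energy _ p nu c (alpha k) beta delta _ (d k) (t k.+1)) => //.
- rewrite d0 /=.
  have [_ tn] := resP k (leqnSn _) (good_all k (leqnSn _)).
  apply: le_trans (dP k (leqnn _) (good_all k (leqnSn _))) _.
  have /= h : eta * t k <= 4^-1 * t k by rewrite ler_wpM2r.
  have : 4 * (tau + 1) * delta <= c * delta by rewrite ler_wpM2r // ltW.
  by move: tn h rN1 td0 (ltW de0) => /=; clear; lra.
- have := energy k (leqnn _).
  have : alpha k * g k.+1 <=
    alpha k * (beta * D k.+1 `^ ((1 - nu) / p) * t k.+1 `^ nu).
    by rewrite ler_wpM2l // ltW.
  have := powR_ge0 (r k) p; clear; lra.
- have jk1 : (j <= k.+1)%N by exact: leqW.
  have rS := resS j jk1.
  have dj : delta <= c0 * wS j.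
    have h : (tau - 1) * delta <= 2 * (Cr * wS j) by move: rj rS; clear; lra.
    rewrite -(ler_pM2r (_ : 0 < tau - 1)); last by rewrite subr_gt0.
    by rewrite mulrC mulrAC c0E -mulrA.
  have wj : wS j <= theta * wS k.
    move: jN jN1; rewrite leq_eqVlt => /orP[/eqP -> _|jk kj].
      by rewrite ler_peMl // ltW.
    have -> : k = j.+1 by apply/eqP; rewrite eqn_leq kj jk.
    exact: wSth.
  apply: le_trans dj _; apply: (@le_trans _ _ (c1 * wS k)).
    by rewrite c1E (mulrC theta) -mulrA ler_wpM2l // ltW.
  by rewrite -wSE ler_wpM2r.
Qed.

(** * Estimates for one Gauss-Newton step *)

(** The points so close to [xdag] that the nonlinearity condition, with
    [K = K0 + K1], bounds the relative linearization error at [xdag] by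
    [eta]. *)
Definition tangential_region (R : realType) (X : normedModType R) (DF : set X)
    (xdag : X) (rho K eta : R) (x : X) : Prop :=
  [/\ DF x, `|x - xdag| < rho & K * `|x - xdag| <= eta].

Section newton_step_estimates.
Context (R : realType) (X Y : normedModType R) (DF : set X) (F : X -> Y)
  (F' : X -> {linear X -> Y}) (xdag : X) (rho K0 K1 : R) (eta delta : R)
  (ydelta : Y).
Context (cDF : convex_set (DF : set (convex_lmodType X)))
  (dF : directional_derivative DF F F' xdag rho)
  (nF : nonlinearity_condition DF F' xdag rho K0 K1)
  (K00 : 0 <= K0) (K10 : 0 <= K1) (rho0 : 0 < rho) (DFdag : DF xdag)
  (eta1 : eta <= 1) (dy : `|ydelta - F xdag| <= delta).

Let T := F' xdag.
Local Notation near_sol :=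
  (tangential_region _ _ DF xdag rho (K0 + K1) eta).
Let dagr : `|xdag - xdag| < rho. Proof. by rewrite subrr normr0. Qed.

(** In the following estimates [T (x - xdag)] is the linearized error at [x]; the
    point [z] is arbitrary in the same region and stands for the next iterate. *)
Lemma linearization_error_dag x : near_sol x ->
  `|F x - F xdag - T (x - xdag)| <= eta * `|T (x - xdag)|.
Proof.
case=> DFx xr xe.
apply: le_trans (linearization_error _ _ _ _ _ _ _ _ _ _ _ _
  cDF dF nF K00 K10 DFdag dagr DFx xr) _.
by rewrite ler_wpM2r.
Qed.

Lemma derivative_perturbation x w (b : R) : near_sol x ->
  (K0 + K1) * `|w| <= b ->
  `|F' x w - T w| <= eta * `|T w| + b * `|T (x - xdag)|.
Proof.
case=> DFx xr xe wb.
apply: le_trans (nF _ _ w (conj DFdag dagr) (conj DFx xr)) _.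
apply: lerD.
  rewrite ler_wpM2r //; apply: le_trans xe.
  by rewrite ler_wpM2r // lerDl.
rewrite mulrAC ler_wpM2r //; apply: le_trans wb.
by rewrite ler_wpM2r // lerDr.
Qed.

Lemma residual_le x : near_sol x ->
  `|F x - ydelta| <= delta + 2 * `|T (x - xdag)|.
Proof.
move=> nx; have h := linearization_error_dag _ nx.
have -> : F x - ydelta =
    (F x - F xdag - T (x - xdag)) + T (x - xdag) + (F xdag - ydelta).
  by rewrite subrK addrA subrK.
have h1 := ler_normD (F x - F xdag - T (x - xdag) + T (x - xdag))
             (F xdag - ydelta).
have h2 := ler_normD (F x - F xdag - T (x - xdag)) (T (x - xdag)).
have dy' : `|F xdag - ydelta| <= delta by rewrite distrC.
have h3 : eta * `|T (x - xdag)| <= 1 * `|T (x - xdag)| by rewrite ler_wpM2r.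
move: dy' h h1 h2 h3; lra.
Qed.

Lemma linearized_error_le x : near_sol x ->
  `|T (x - xdag)| <= `|F x - ydelta| + delta + eta * `|T (x - xdag)|.
Proof.
move=> nx; have h := linearization_error_dag _ nx.
have tE : T (x - xdag) = (F x - ydelta) + (ydelta - F xdag)
    - (F x - F xdag - T (x - xdag)).
  by rewrite [X in _ = X - _]addrA subrK subKr.
have h1 := ler_normB ((F x - ydelta) + (ydelta - F xdag))
             (F x - F xdag - T (x - xdag)).
have h2 := ler_normD (F x - ydelta) (ydelta - F xdag).
by rewrite -tE in h1; move: (dy) h h1 h2; lra.
Qed.

Lemma exact_linear_residual x : near_sol x ->
  `|F xdag - F x - F' x (xdag - x)| <= 2 * eta * `|T (x - xdag)| /\
  `|ydelta - F x - F' x (xdag - x)| <= delta + 2 * eta * `|T (x - xdag)|.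
Proof.
move=> nx; have [DFx xr xe] := nx.
have h : `|F' x (xdag - x)| <= 2 * `|T (x - xdag)|.
  have h1 := derivative_perturbation _ (x - xdag) _ nx xe.
  have -> : `|F' x (xdag - x)| = `|(F' x (x - xdag) - T (x - xdag)) + T (x - xdag)|.
    by rewrite subrK -opprB raddfN normrN.
  have h2 := ler_normD (F' x (x - xdag) - T (x - xdag)) (T (x - xdag)).
  have h3 : (K0 + K1) * `|x - xdag| * `|T (x - xdag)| <= eta * `|T (x - xdag)|.
    by rewrite ler_wpM2r.
  apply: le_trans h2 _.
  have := nF _ _ (x - xdag) (conj DFdag dagr) (conj DFx xr).
  have h4 : eta * `|T (x - xdag)| <= 1 * `|T (x - xdag)| by rewrite ler_wpM2r.
  rewrite -/T; move: h3 h4; lra.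
have e0 : 0 <= eta by apply: le_trans xe; rewrite mulr_ge0 // addr_ge0.
have h1 : `|F xdag - F x - F' x (xdag - x)| <= 2 * eta * `|T (x - xdag)|.
  apply: le_trans (linearization_error _ _ _ _ _ _ _ _ _ _ _ _
    cDF dF nF K00 K10 DFx xr DFdag dagr) _.
  rewrite distrC (mulrC 2) -[leRHS]mulrA.
  by apply: ler_pM => //; rewrite mulr_ge0 // addr_ge0.
split => //.
have -> : ydelta - F x - F' x (xdag - x) =
    (ydelta - F xdag) + (F xdag - F x - F' x (xdag - x)).
  by rewrite addrA addrA subrK.
by apply: le_trans (ler_normD _ _) _; exact: lerD.
Qed.

Lemma newton_step_estimates x z : near_sol x -> near_sol z ->
  let r := `|ydelta - F x - F' x (z - x)| in
  `|T (z - xdag)| <= r + delta + 3 * eta * `|T (x - xdag)|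
                     + eta * `|T (z - xdag)| /\
  `|F z - ydelta| <= r + 3 * eta * `|T (x - xdag)| + 2 * eta * `|T (z - xdag)|.
Proof.
move=> nx nz; have [_ _ ze] := nz.
have [h1 h2] := exact_linear_residual _ nx.
have h3 := derivative_perturbation _ (z - xdag) _ nx ze.
have h4 := linearization_error_dag _ nz.
set rv := ydelta - F x - F' x (z - x).
set dv := ydelta - F x - F' x (xdag - x) in h2.
set lv := F xdag - F x - F' x (xdag - x) in h1.
have cE : F' x (z - xdag) = dv - rv.
  have sub2 (A b c : Y) : A - b - (A - c) = c - b.
    by rewrite opprB addrC addrA subrK.
  by rewrite sub2 -raddfB opprB addrA subrK.
have lE : F' x (z - xdag) - (ydelta - F xdag) = lv - rv.
  have sub3 (A b c d : Y) : A - b - c - (A - d) = d - b - c.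
    by rewrite opprB addrC (addrA (d - A)) (addrA (d - A)) subrK.
  by rewrite cE addrAC; congr (_ - rv); exact: sub3.
split.
  have tE : T (z - xdag) = dv - rv - (F' x (z - xdag) - T (z - xdag)).
    by rewrite -cE subKr.
  have h5 := ler_normB (dv - rv) (F' x (z - xdag) - T (z - xdag)).
  have h6 := ler_normB dv rv.
  by rewrite -tE in h5; move: h2 h3 h5 h6; lra.
have -> : F z - ydelta = (F z - F xdag - T (z - xdag))
    - (F' x (z - xdag) - T (z - xdag)) + (lv - rv).
  rewrite -lE.
  have -> : F z - F xdag - T (z - xdag) - (F' x (z - xdag) - T (z - xdag)) =
      F z - F xdag - F' x (z - xdag).
    by rewrite opprB addrA subrK.
  by rewrite addrA subrK opprB addrA subrK.
have h5 := ler_normD (F z - F xdag - T (z - xdag)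
    - (F' x (z - xdag) - T (z - xdag))) (lv - rv).
have h6 := ler_normB (F z - F xdag - T (z - xdag))
    (F' x (z - xdag) - T (z - xdag)).
have h7 := ler_normB lv rv.
by move: h1 h3 h4 h5 h6 h7; lra.
Qed.

End newton_step_estimates.

Lemma restrict_to_fin (R : realType) (X : normedModType R) (DF : set X)
    (Theta : X -> \bar R) x :
  (restrict_to DF Theta x < +oo)%E ->
  [/\ DF x, (Theta x < +oo)%E & restrict_to DF Theta x = Theta x].
Proof.
rewrite /restrict_to; case: ifPn => [/set_mem DFx|_]; last by rewrite ltxx.
by move=> Tx; split.
Qed.

Lemma restrict_to_in (R : realType) (X : normedModType R) (DF : set X)
    (Theta : X -> \bar R) x :
  DF x -> restrict_to DF Theta x = Theta x.
Proof. by move=> DFx; rewrite /restrict_to mem_set. Qed.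

Lemma restrict_to_proper (R : realType) (X : normedModType R) (DF : set X)
    (Theta : X -> \bar R) x :
  proper_function Theta -> DF x -> (Theta x < +oo)%E ->
  proper_function (restrict_to DF Theta).
Proof.
move=> [Tn _] DFx Tx; split; last by exists x; rewrite restrict_to_in.
by move=> z; rewrite /restrict_to; case: ifP.
Qed.

(** Comparing [x0] with [xdag] in the problem defining [x0]. *)
Lemma initial_minimizer (R : realType) (X : normedModType R) (DF : set X)
    (Theta : X -> \bar R) (xi0 : {linear X -> R^o}) (x0 xdag : X) :
  proper_function Theta -> DF xdag -> (Theta xdag < +oo)%E ->
  minimizes (fun z => restrict_to DF Theta z - (xi0 z)%:E)%E x0 ->
  [/\ DF x0, (Theta x0 < +oo)%E &
      fine (Theta x0) - xi0 x0 <= fine (Theta xdag) - xi0 xdag].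
Proof.
move=> pT DFdag Tdag /(_ xdag).
rewrite (restrict_to_in _ _ _ _ _ DFdag) -(proper_fineK _ _ _ _ pT Tdag) => h.
have T0 : (restrict_to DF Theta x0 < +oo)%E.
  rewrite ltey; apply/eqP => T0; move: h; rewrite T0 -EFinB.
  by rewrite leye_eq.
have [DF0 Tx0 E0] := restrict_to_fin _ _ _ _ _ T0.
split => //; move: h; rewrite E0 -(proper_fineK _ _ _ _ pT Tx0).
by rewrite -!EFinB lee_fin.
Qed.

(** Comparing the new iterate with [xdag] in the minimization problem of one
    Gauss-Newton step. *)
Lemma newton_minimizer (R : realType) (X Y : normedModType R) (DF : set X)
    (Theta : X -> \bar R) (F : X -> Y) (F' : X -> {linear X -> Y})
    (ydelta : Y) (xi0 : {linear X -> R^o}) (p a : R) (x0 xn x xdag : X) :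
  proper_function Theta -> 0 < a -> DF xdag -> (Theta xdag < +oo)%E ->
  DF x0 -> (Theta x0 < +oo)%E ->
  minimizes (gauss_newton_functional p (restrict_to DF Theta) F F' ydelta xi0
               x0 a xn) x ->
  [/\ DF x, (Theta x < +oo)%E &
      `|ydelta - F xn - F' xn (x - xn)| `^ p
        + a * (fine (Theta x) - xi0 x)
      <= `|ydelta - F xn - F' xn (xdag - xn)| `^ p
        + a * (fine (Theta xdag) - xi0 xdag)].
Proof.
move=> pT a0 DFdag Tdag DF0 T0 /(_ xdag).
rewrite /gauss_newton_functional /bregman.
rewrite (restrict_to_in _ _ _ _ _ DFdag) (restrict_to_in _ _ _ _ _ DF0).
rewrite -(proper_fineK _ _ _ _ pT Tdag) -(proper_fineK _ _ _ _ pT T0).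
rewrite -!EFinB -EFinM -EFinD => h.
have Tx : (restrict_to DF Theta x < +oo)%E.
  rewrite ltey; apply/eqP => Tx; move: h; rewrite Tx.
  by rewrite -!EFinN !addye // gt0_muley ?lte_fin // addey // leye_eq.
have [DFx Tx' Ex] := restrict_to_fin _ _ _ _ _ Tx.
split => //; move: h; rewrite Ex -(proper_fineK _ _ _ _ pT Tx').
rewrite -!EFinB -EFinM -EFinD lee_fin !raddfB /=; lra.
Qed.

(* The threshold eps for (K0 + K1) * ||xi0 - xidag||^(1/(p-1)) depends only on
   p, gamma, theta, tau, nu, rho, K0, K1. When K0 + K1 > 0 it forces the
   iterates x 0, ..., x N into the ball of radius rho around xdag. When
   K0 = K1 = 0 it says nothing, and that the iterates lie where F' is given has
   to be part of the method being well defined. *)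
Theorem theorem4p1 (R : realType) (p gamma theta tau nu : R) :
  2 <= p -> 0 < gamma -> 1 < theta -> 1 < tau -> 0 < nu <= 1 ->
  exists C : R, 0 < C /\
  forall rho K0 K1 : R, 0 < rho -> 0 <= K0 -> 0 <= K1 ->
  exists eps : R, 0 < eps /\
  forall (X Y : completeNormedModType R)
    (Theta : X -> \bar R) (alpha : nat -> R)
    (DF : set X) (F : X -> Y) (F' : X -> {linear X -> Y})
    (y : Y) (xdag : X),
  let Theta_F := restrict_to DF Theta in
  let T := F' xdag in
  proper_function Theta -> lower_semicontinuous Theta ->
  p_convex p Theta -> bregman_constant p gamma Theta ->
  (forall n, 0 < alpha n) ->
  (forall n, 1 <= alpha n / alpha n.+1 <= theta) ->
  alpha n @[n --> \oo] --> 0 ->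
  closed DF -> convex_set (DF : set (convex_lmodType X)) ->
  DF xdag -> dom_subdifferential Theta xdag -> F xdag = y ->
  directional_derivative DF F F' xdag rho ->
  opnorm T <= alpha 0%N `^ p^-1 / gamma ->
  nonlinearity_condition DF F' xdag rho K0 K1 ->
  forall (xi0 xidag : {linear X -> R^o}) (beta : R),
  continuous (xi0 : X -> R^o) ->
  nearest_in (subdifferential Theta_F xdag) xi0 xidag ->
  0 <= beta ->
  source_condition p nu beta Theta_F xi0 xidag xdag T ->
  (K0 + K1) * opnorm (xi0 \- xidag) `^ (p - 1)^-1 <= eps ->
  forall (delta : R) (ydelta : Y) (x : nat -> X) (N : nat),
  0 < delta -> `|ydelta - y| <= delta ->
  gauss_newton_iterates p Theta_F F F' ydelta xi0 alpha x N ->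
  (K0 + K1 = 0 -> forall n, (n <= N)%N -> `|x n - xdag| < rho) ->
  let res n := `|F (x n) - ydelta| in
  stops_mean res (tau * delta) N \/ stops_max res (tau * delta) N ->
  (bregman Theta_F xidag (x N) xdag
     <= (C * beta `^ (p / (p - 1 + nu))
           * delta `^ (p * nu / (p - 1 + nu)))%:E)%E /\
  `|x N - xdag|
     <= C * beta `^ ((p - 1 + nu)^-1) * delta `^ (nu / (p - 1 + nu)).
Proof.
move=> p2 g0 th1 tau1 nu01.
have [eta [A [C1 [/andP[eta0 eta4] A0 C10 rates]]]] :=
  abstract_rates R p gamma theta tau nu p2 g0 th1 tau1 nu01.
have /andP[nu0 nu1] := nu01.
have p0 : 0 < p by lra.
have pn0 : p != 0 by rewrite gt_eqF.
have q0 : 0 < p - 1 + nu by lra.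
have qn0 : p - 1 + nu != 0 by rewrite gt_eqF.
have eta1 : eta <= 1 by lra.
have C1p : 0 <= gamma * C1 `^ p^-1 by rewrite mulr_ge0 ?powR_ge0 // ltW.
exists (C1 + gamma * C1 `^ p^-1); split; first by rewrite ltr_pwDl.
move=> rho K0 K1 rho0 K00 K10.
have K_ge0 : 0 <= K0 + K1 by rewrite addr_ge0.
(* the first bound keeps (K0 + K1) |e_n| below [eta], the second one keeps the
   iterates in the ball of radius [rho] *)
exists (if K0 + K1 == 0 then 1
        else Num.min (eta / A) (rho * (K0 + K1) / (2 * A))).
split.
  case: ifPn => // Kn0; have K_gt0 : 0 < K0 + K1 by rewrite lt_def Kn0.
  by rewrite lt_min !divr_gt0 ?mulr_gt0.
move=> X Y Theta alpha DF F F' y xdag Theta_F T pT lT pcT gT a0 ath _ _ cDF.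
move=> DFdag Tdag Fdag dF opT nF xi0 xidag beta xi0c [xidags _] b0 src small.
move=> delta ydelta x N de0 dy [min0 minS] Kball res stop.
have Tdagf := Tdag.1.
have pTF := restrict_to_proper _ _ _ _ _ pT DFdag Tdagf.
have dagF : (Theta_F xdag < +oo)%E by rewrite /Theta_F restrict_to_in.
pose h z := fine (Theta z).
pose Dl z : R := h z - h xdag - xidag (z - xdag).
have xidag_sub z : DF z -> (Theta z < +oo)%E -> h xdag + xidag (z - xdag) <= h z.
  have [/(_ xidags.2) sub _] := subdifferential_fine _ _ _ _ xidag pTF dagF.
  move=> DFz Tz; have := sub z; rewrite /Theta_F !restrict_to_in //.
  by apply.
have bregE z : DF z -> (Theta z < +oo)%E ->
    bregman Theta_F xidag z xdag = (Dl z)%:E.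
  move=> DFz Tz; rewrite /bregman /Theta_F !restrict_to_in //.
  by rewrite -(proper_fineK _ _ _ _ pT Tz) -(proper_fineK _ _ _ _ pT Tdagf)
     -!EFinB.
have Dl_ge z : DF z -> (Theta z < +oo)%E ->
    `|z - xdag| `^ p <= gamma `^ p * Dl z.
  move=> DFz Tz.
  apply: (bregman_restrict_ge _ _ _ _ _ DF xdag) => //.
  by move=> u v a DFu DFv a01; exact: convex_set_combination.
have Dl0 z : DF z -> (Theta z < +oo)%E -> 0 <= Dl z.
  by move=> DFz Tz; rewrite /Dl; have := xidag_sub z DFz Tz; lra.
have [DF0 Tx0 le0] := initial_minimizer _ _ _ _ _ _ _ pT DFdag Tdagf min0.
have minN n : (n < N)%N -> [/\ DF (x n.+1), (Theta (x n.+1) < +oo)%E & _] :=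
  fun nN => newton_minimizer _ _ _ _ _ _ _ _ _ _ _ _ _ _ _ pT (a0 n) DFdag Tdagf
              DF0 Tx0 (minS n nN).
have xfin n : (n <= N)%N -> DF (x n) /\ (Theta (x n) < +oo)%E.
  by case: n => [//|n nN]; have [] := minN n nN.
pose E := opnorm (xi0 \- xidag).
have dc : continuous ((xi0 \- xidag : {linear X -> R^o}) : X -> R^o).
  by move=> z; apply: continuousB; [exact: xi0c|exact: xidags.1].
have E0 : 0 <= E by exact: (opnorm_ge0 _ _ _ (xi0 \- xidag : {linear X -> R^o})).
have Ebd z : xi0 z - xidag z <= E * `|z|.
  apply: le_trans (ler_norm _) _.
  exact: (opnorm_ge _ _ _ (xi0 \- xidag : {linear X -> R^o})).
have dagreg : DF xdag /\ `|xdag - xdag| < rho by rewrite subrr normr0.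
have Tc : continuous T by case: (dF xdag dagreg).
have dyF : `|ydelta - F xdag| <= delta by rewrite Fdag.
pose e n := `|x n - xdag|.
pose t n := `|T (x n - xdag)|.
pose g n : R := xi0 (x n - xdag) - xidag (x n - xdag).
pose r n := `|ydelta - F (x n) - F' (x n) (x n.+1 - x n)|.
pose d n := `|ydelta - F (x n) - F' (x n) (xdag - x n)|.
pose good n := tangential_region _ _ DF xdag rho (K0 + K1) eta (x n).
have DN : Dl (x N) <= C1 * beta `^ (p / (p - 1 + nu))
            * delta `^ (p * nu / (p - 1 + nu)).
  apply: (rates N beta delta E alpha e t (Dl \o x) g res r d good) => //.
  - by move=> n; split; exact: normr_ge0.
  - move=> n nN; have [DFn Tn] := xfin n nN; split.
    + exact: Dl0.
    + exact: Dl_ge.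
    + exact: Ebd.
    + have := src (x n); rewrite (bregE _ DFn Tn) poweR_EFin -!EFinM lee_fin.
      by apply => _; exact: ltry.
  - rewrite /= /Dl /g !raddfB /=; rewrite -/(h _) -/(h _) in le0.
    move: le0; lra.
  - apply: le_trans (opnorm_ge _ _ _ T (x 0%N - xdag) Tc) _.
    by rewrite ler_wpM2r.
  - move=> n nN; have [_ _] := minN n nN.
    rewrite -/(h _) -/(h _) -/(r n) -/(d n) /= /Dl /g.
    have -> : h (x n.+1) - h xdag - xidag (x n.+1 - xdag) =
       (h (x n.+1) - xi0 (x n.+1)) - (h xdag - xi0 xdag)
       + (xi0 (x n.+1 - xdag) - xidag (x n.+1 - xdag)).
      by rewrite (raddfB xi0) /=; ring.
    by rewrite mulrDr mulrBr; lra.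
  - move=> n nN eA; have [DFn _] := xfin n nN.
    have [K0E|Kn0] := eqVneq (K0 + K1) 0.
      by split => //; [exact: Kball|rewrite K0E mul0r ltW].
    have K_gt0 : 0 < K0 + K1 by rewrite lt_def Kn0.
    move: small; rewrite (negbTE Kn0) le_min -/E => /andP[s1 s2].
    split => //.
      apply: (@le_lt_trans _ _ (A * E `^ (p - 1)^-1)) => //.
      rewrite -(ltr_pM2l K_gt0) mulrCA.
      apply: (@le_lt_trans _ _ (A * (rho * (K0 + K1) / (2 * A)))).
        by rewrite ler_wpM2l // ltW.
      have -> : A * (rho * (K0 + K1) / (2 * A)) = (K0 + K1) * rho / 2.
        by field; rewrite gt_eqF.
      by rewrite ltr_pdivrMr // ltr_pMr ?mulr_gt0 // ltr1n.
    apply: (@le_trans _ _ ((K0 + K1) * (A * E `^ (p - 1)^-1))).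
      by rewrite ler_wpM2l.
    rewrite mulrCA; apply: (@le_trans _ _ (A * (eta / A))).
      by rewrite ler_wpM2l // ltW.
    by rewrite mulrC divfK // gt_eqF.
  - move=> n nN gn; split.
      exact: (residual_le _ _ _ _ _ _ _ _ _ _ _ _ _ cDF dF nF K00 K10 rho0
                DFdag eta1 dyF _ gn).
    exact: (linearized_error_le _ _ _ _ _ _ _ _ _ _ _ _ _ cDF dF nF K00 K10
              rho0 DFdag dyF _ gn).
  - move=> n nN gn.
    by have [] := exact_linear_residual _ _ _ _ _ _ _ _ _ _ _ _ _ cDF dF nF K00
                    K10 rho0 DFdag eta1 dyF _ gn.
  - move=> n nN gn gn1.
    exact: (newton_step_estimates _ _ _ _ _ _ _ _ _ _ _ _ _ cDF dF nF K00 K10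
              rho0 DFdag eta1 dyF _ _ gn gn1).
have [DFN TN] := xfin N (leqnn N).
set bq := beta `^ _ in DN *; set dq := delta `^ _ in DN *.
have bd0 : 0 <= bq * dq by rewrite mulr_ge0 ?powR_ge0.
split.
  rewrite bregE // lee_fin; apply: le_trans DN _.
  by rewrite -!mulrA ler_wpM2r // lerDl.
apply: (@le_trans _ _ (gamma * (C1 * bq * dq) `^ p^-1)).
  apply: (powR_le_cancel _ p) => //; first by rewrite mulr_ge0 ?powR_ge0 // ltW.
  apply: le_trans (Dl_ge _ DFN TN) _.
  rewrite powRM ?powR_ge0 ?(ltW g0) // powRVK //; last first.
    by rewrite -mulrA mulr_ge0 // ltW.
  by rewrite ler_wpM2l ?powR_ge0.
rewrite -(mulrA C1) powRM ?(ltW C10) // powRM ?powR_ge0 // /bq /dq -!powRrM.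
have -> : p / (p - 1 + nu) * p^-1 = (p - 1 + nu)^-1.
  by field; rewrite pn0 qn0.
have -> : p * nu / (p - 1 + nu) * p^-1 = nu / (p - 1 + nu).
  by field; rewrite pn0 qn0.
rewrite mulrA -[leRHS]mulrA ler_wpM2r ?mulr_ge0 ?powR_ge0 //.
by rewrite lerDr ltW.
Qed.
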